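(* Let $K=K_x\times K_y$ with $K_x\subset\mathbb{R}^n$, $K_y\subset\mathbb{R}^m$ closed convex sets, let $\varphi$ be $C^2$ and concave-convex on $K$, and let $\mathbf{0}\in K$ be a $K$-restricted saddle point of $\varphi$. Consider the subgradient method on $K$ applied to $\varphi$. Let $F$ be the minimal face of $K$ that contains all $K$-restricted saddle points, let $V$ be the affine span of $F$, and let $\mathbf{\Pi}$ be the orthogonal projection matrix onto the orthogonal complement of $N_V$. Then any trajectory $\mathbf{z}(t)$ in the $\omega$-limit set of the subgradient method satisfies the linear ODE $$\dot{\mathbf{z}}(t)=\mathbf{\Pi}\mathbf{A}(\mathbf{0})\mathbf{\Pi}\mathbf{z}(t)$$ and, for all $r\in[0,1]$ and $t\in\mathbb{R}$, $$\mathbf{z}(t)\in\ker(\mathbf{\Pi}\mathbf{B}(r\mathbf{z}(t))\mathbf{\Pi})\cap\ker(\mathbf{\Pi}(\mathbf{A}(r\mathbf{z}(t))-\mathbf{A}(\mathbf{0}))\mathbf{\Pi}).$$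
   Context: $\varphi(x,y)$, $x\in\mathbb{R}^n$, $y\in\mathbb{R}^m$, is concave-convex if it is concave in $x$ and convex in $y$. A $K$-restricted saddle point is $(\bar x,\bar y)\in K$ with $\varphi(x,\bar y)\le\varphi(\bar x,\bar y)\le\varphi(\bar x,y)$ for all $x,y$ with $(x,\bar y),(\bar x,y)\in K$. The matrices $\mathbf{A},\mathbf{B}$ are $$\mathbf{A}(\mathbf{z})=\begin{bmatrix}0&\varphi_{xy}(\mathbf{z})\\-\varphi_{yx}(\mathbf{z})&0\end{bmatrix},\qquad \mathbf{B}(\mathbf{z})=\begin{bmatrix}\varphi_{xx}(\mathbf{z})&0\\0&-\varphi_{yy}(\mathbf{z})\end{bmatrix}.$$ The normal cone is $N_K(\mathbf{z})=\{\mathbf{w}:\mathbf{w}^T(\mathbf{z}'-\mathbf{z})\le0\ \forall \mathbf{z}'\in K\}$ for $\mathbf{z}\in K$; for an affine subspace $V$ it is independent of $\mathbf{z}\in V$ and denoted $N_V$. $\mathbf{P}_C$ is Euclidean projection onto $C$. The subgradient method on $K$ applied to $\varphi$ is the semi-flow $\phi$ on $K$ (with Euclidean metric) consisting of Carathéodory solutions (absolutely continuous, satisfying the equation for almost all $t$) of $\dot{\mathbf{z}}=\mathbf{f}(\mathbf{z})-\mathbf{P}_{N_K(\mathbf{z})}(\mathbf{f}(\mathbf{z}))$, $\mathbf{f}=(\varphi_x,-\varphi_y)$. Its $\omega$-limit set is $\Omega=\bigcup_{\mathbf{x}\in K}\bigcap_{t\ge0}\overline{\phi([t,\infty),\mathbf{x})}$;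 a trajectory in the $\omega$-limit set is a trajectory $\mathbf{z}(t)$, $t\in\mathbb{R}$, lying in $\Omega$ for all times (through each point of $\Omega$ there is exactly one such). A face of $K$ is a convex subset $F\subseteq K$ such that every line segment $L\subseteq K$ with $(\operatorname{relint}L)\cap F\neq\emptyset$ satisfies $L\subseteq F$. The minimal face containing a set is the intersection of all faces containing it. *)

(* Defs.v *)
From HB Require Import structures.
From mathcomp Require Import all_boot all_order all_algebra.
From mathcomp Require Import all_classical all_reals all_analysis.

Set Implicit Arguments.
Unset Strict Implicit.
Unset Printing Implicit Defensive.

Import Order.TTheory GRing.Theory Num.Theory.
Import numFieldNormedType.Exports.

Local Open Scope classical_set_scope.
Local Open Scope ring_scope.

(* Points of R^k are column vectors.  The topology, limits and derivatives on
   'cV[R]_k are the library's (built on the maximum norm, hence the usual ones);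
   the Euclidean structure, needed for projections and normal cones, is given by
   dot and enorm below. *)
Section Euclidean.
Variables (R : realType) (k : nat).
Implicit Types (u v w z p : 'cV[R]_k) (C K F V W S : set 'cV[R]_k).

Definition dot u v : R := (u^T *m v) 0 0.

Definition enorm u : R := Num.sqrt (dot u u).

(* The default value 0 is only used when there is no nearest point, which never
   happens for C closed, convex and nonempty. *)
Definition euclid_proj C u : 'cV[R]_k :=
  xget 0 [set p | C p /\ forall q, C q -> enorm (u - p) <= enorm (u - q)].

Definition projection_mx W : 'M[R]_k :=
  \matrix_(i, j) euclid_proj W (delta_mx j 0) i 0.

Definition orth_compl W : set 'cV[R]_k :=
  [set u | forall w, W w -> dot u w = 0].

Definition normal_cone K z : set 'cV[R]_k :=
  [set w | forall z', K z' -> dot w (z' - z) <= 0].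

(* For V affine and nonempty, normal_cone V z is the same for all z in V. *)
Definition affine_normal_cone V : set 'cV[R]_k :=
  [set w | forall z, V z -> normal_cone V z w].

Definition segment u v : set 'cV[R]_k :=
  [set (1 - t) *: u + t *: v | t in `[0, 1]%classic].

Definition relint_segment u v : set 'cV[R]_k :=
  [set (1 - t) *: u + t *: v | t in `]0, 1[%classic].

Definition face K F : Prop :=
  [/\ F `<=` K, convex_set F &
      forall u v, segment u v `<=` K -> relint_segment u v `&` F !=set0 ->
        segment u v `<=` F].

Definition minimal_face K S : set 'cV[R]_k :=
  \bigcap_(F in [set F | face K F /\ S `<=` F]) F.

Definition affine_span S : set 'cV[R]_k :=
  [set z | exists (l : nat) (c : 'I_l -> R) (s : 'I_l -> 'cV[R]_k),
     [/\ forall i, S (s i), \sum_(i < l) c i = 1 &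
         z = \sum_(i < l) c i *: s i]].

Definition colker (M : 'M[R]_k) : set 'cV[R]_k := [set v | M *m v = 0].

Definition pderiv (i : 'I_k) (f : 'cV[R]_k -> R) z : R :=
  'D_(delta_mx i 0 : 'cV[R]_k) (f : 'cV[R]_k -> R^o) z.

Definition gradient (f : 'cV[R]_k -> R) z : 'cV[R]_k :=
  \col_i pderiv i f z.

Definition hessian (f : 'cV[R]_k -> R) z : 'M[R]_k :=
  \matrix_(i, j) pderiv i (pderiv j f) z.

Definition C1_on (U : set 'cV[R]_k) (f : 'cV[R]_k -> R) : Prop :=
  forall z, U z -> forall i : 'I_k,
    derivable (f : 'cV[R]_k -> R^o) z (delta_mx i 0 : 'cV[R]_k) /\
    {for z, continuous (pderiv i f)}.

Definition C2_on (U : set 'cV[R]_k) (f : 'cV[R]_k -> R) : Prop :=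
  C1_on U f /\ forall i : 'I_k, C1_on U (pderiv i f).

(* On a closed set, C^2 means C^2 on some open neighbourhood of the set. *)
Definition C2_on_closed K (f : 'cV[R]_k -> R) : Prop :=
  exists U, [/\ open U, K `<=` U & C2_on U f].

Definition abs_continuous (a b : R) (z : R -> 'cV[R]_k) : Prop :=
  forall e : R, 0 < e -> exists2 d : R, 0 < d &
    forall (l : nat) (s t : 'I_l -> R),
      (forall i, [/\ a <= s i, s i <= t i & t i <= b]) ->
      (forall i j, i != j -> t i <= s j \/ t j <= s i) ->
      \sum_(i < l) (t i - s i) < d ->
      \sum_(i < l) enorm (z (t i) - z (s i)) < e.

(* Caratheodory solutions, on the time interval I, of the projected equation
   z' = f z - P_(N_K(z)) (f z) on K. Absolute continuity is required on the
   compact subintervals of I. *)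
Definition projected_solution K (f : 'cV[R]_k -> 'cV[R]_k) (I : set R)
    (z : R -> 'cV[R]_k) : Prop :=
  [/\ forall t, I t -> K (z t),
      forall a b, I a -> I b -> abs_continuous a b z &
      {ae @lebesgue_measure R, forall t, I t ->
        is_derive (t : R^o) (1 : R^o) (z : R^o -> 'cV[R]_k)
          (f (z t) - euclid_proj (normal_cone K (z t)) (f (z t)))}].

(* The orbit t |-> phi(t, x) of the semi-flow is represented by the solutions
   on [0, +oo[ issued from x. *)
Definition omega_limit K (f : 'cV[R]_k -> 'cV[R]_k) : set 'cV[R]_k :=
  \bigcup_(x in K)
  \bigcup_(z in [set z | projected_solution K f `[0, +oo[%classic z /\ z 0 = x])
  \bigcap_(t in `[0, +oo[%classic) closure (z @` `[t, +oo[%classic).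

Definition omega_limit_trajectory K (f : 'cV[R]_k -> 'cV[R]_k)
    (z : R -> 'cV[R]_k) : Prop :=
  projected_solution K f setT z /\ forall t, omega_limit K f (z t).

End Euclidean.

Section SaddlePoint.
Variables (R : realType) (n m : nat).
Implicit Types (Kx : set 'cV[R]_n) (Ky : set 'cV[R]_m)
  (K : set 'cV[R]_(n + m)) (phi : 'cV[R]_(n + m) -> R) (z : 'cV[R]_(n + m)).

(* The pair (x, y) is the stacked vector col_mx x y. *)
Definition prod_set Kx Ky : set 'cV[R]_(n + m) :=
  [set z | Kx (usubmx z) /\ Ky (dsubmx z)].

Definition concave_convex Kx Ky phi : Prop :=
  (forall y, Ky y -> convex_function Kx (fun x => - phi (col_mx x y))) /\
  (forall x, Kx x -> convex_function Ky (fun y => phi (col_mx x y))).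

Definition saddle_point K phi z : Prop :=
  K z /\
  forall (x : 'cV[R]_n) (y : 'cV[R]_m),
    K (col_mx x (dsubmx z)) -> K (col_mx (usubmx z) y) ->
    phi (col_mx x (dsubmx z)) <= phi z /\
    phi z <= phi (col_mx (usubmx z) y).

Definition saddle_field phi z : 'cV[R]_(n + m) :=
  col_mx (usubmx (gradient phi z)) (- dsubmx (gradient phi z)).

Definition Amx phi z : 'M[R]_(n + m) :=
  block_mx 0 (ursubmx (hessian phi z)) (- dlsubmx (hessian phi z)) 0.

Definition Bmx phi z : 'M[R]_(n + m) :=
  block_mx (ulsubmx (hessian phi z)) 0 0 (- drsubmx (hessian phi z)).

End SaddlePoint.

(* Main.v *)
(** The field f = (phi_x, - phi_y) is antitone on K, and its equilibria are the
    saddle points.  Hence two solutions never move apart, and a trajectory z in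
    the omega-limit set, being recurrent, moves by isometries at constant
    distance from every saddle point.  The point of least norm of the closed
    convex hull of its orbit is fixed by this motion, so it satisfies Minty's
    inequality and is a saddle point; by compactness it charges every
    neighbourhood of z(t) with positive weight, so the face property puts z(t)
    in V.  Constant distance to a saddle point s also gives f(z).(z - s) = 0 and
    n.(z - s) = 0 for the normal component n of f(z).  Then n, f(0) and
    r f(z) + (1 - r) f(0) - f(r z) define exposed faces of K containing all
    saddle points, so Pi annihilates them: z' = Pi f(z) and
    Pi f(r z) = r Pi f(z).  Differentiating the last identity in r, where
    f' = A + B with A skew and B symmetric and nonpositive, gives the kernel
    conditions and the linear equation. *)

Require Import Defs.
From HB Require Import structures.
From mathcomp Require Import all_boot all_order all_algebra.
From mathcomp Require Import all_classical all_reals all_analysis.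
From mathcomp Require Import measurable_realfun ring lra.

Set Implicit Arguments.
Unset Strict Implicit.
Unset Printing Implicit Defensive.

Import Order.TTheory GRing.Theory Num.Theory.
Import numFieldNormedType.Exports.

Local Open Scope classical_set_scope.
Local Open Scope ring_scope.

(** Convexity is assumed on [K] only, and [K] may have empty interior, so the quadratic form of B is
    known to be nonpositive only along directions that stay in [K]. Its polar form is therefore
    computed at r q with 0 < r < 1, where one can move both ways along the ray while taking a small
    step towards a point of [K]; the ends r = 0 and r = 1 follow by continuity. The equation holds
    at almost every time only. Estimates are thus bounds on increments of absolutely continuous
    functions, and almost sure identities are extended to all times by continuity. The fixed point
    is found without time averages: convex combinations of time shifts of z are kept as curves, to
    which invariance of scalar products extends by bilinearity, and the point of least norm is
    approximated by such a curve uniformly in time. Along this curve only tests against a fixed w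
    survive, which is why Minty's inequality appears. The weight near z(t) must not degenerate as
    the approximation improves; a finite cover of the orbit fixes it beforehand. *)

Section Calculus.
Context {R : realType}.

(** The difference quotient is cleared of its denominator, so the bound is trivial at [h = 0] and
    later estimates need no case distinction. *)
Lemma is_derive_epsP {V W : normedModType R} (f : V -> W) x v df :
  is_derive x v f df <->
  forall e : R, 0 < e -> exists2 d : R, 0 < d &
    forall h : R, `|h| < d -> `|f (h *: v + x) - f x - h *: df| <= e * `|h|.
Proof.
have quotE h : h != 0 -> `|df - h^-1 *: (f (h *: v + x) - f x)| =
    `|h|^-1 * `|f (h *: v + x) - f x - h *: df|.
  move=> h0; rewrite distrC -normfV -normrZ [in RHS]scalerBr scalerA mulVf//.
  by rewrite scale1r.
split.
- move=> [fx fE] e e0; have /cvgrPdist_le/(_ e e0) := fx.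
  rewrite -[lim _]/('D_v f x) fE => /nbhs_ballP[d /= d0 dP].
  exists d => // h hd; have [->|h0] := eqVneq h 0.
    by rewrite scale0r add0r subrr scale0r subr0 !normr0 mulr0.
  have := dP h; rewrite /ball/= sub0r normrN => /(_ hd h0).
  by rewrite quotE// ler_pdivrMl ?normr_gt0// mulrC.
- move=> H.
  have cv : (fun h => h^-1 *: ((f \o shift x) (h *: v) - f x)) @ 0^' --> df.
    apply/cvgrPdist_le => e e0; have [d d0 dP] := H e e0.
    apply/nbhs_ballP; exists d => // h; rewrite /ball/= sub0r normrN => hd h0.
    by rewrite quotE// ler_pdivrMl ?normr_gt0// mulrC; exact: dP.
  split; first by apply/cvg_ex; exists df.
  exact: (cvg_lim _ cv).
Qed.

Lemma continuous_epsP {V W : normedModType R} (f : V -> W) x :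
  {for x, continuous f} <->
  forall e : R, 0 < e -> exists2 d : R, 0 < d &
    forall y, `|y - x| < d -> `|f y - f x| < e.
Proof.
split.
- move=> fx e e0; have /cvgrPdist_lt/(_ e e0)/nbhs_ballP[d /= d0 dP] := fx.
  exists d => // y yd; have := dP y; rewrite -ball_normE/= distrC => /(_ yd).
  by rewrite distrC.
- move=> H; apply/cvgrPdist_lt => e e0; have [d d0 dP] := H e e0.
  apply/nbhs_ballP; exists d => // y; rewrite -ball_normE/= distrC => yd.
  by rewrite distrC; exact: dP.
Qed.

End Calculus.

(** * Null sets of the real line *)

Section NullSets.
Context {R : realType}.
Local Notation mu := (@lebesgue_measure R).

(** The pushforward of [mu] by the translation agrees with [mu] on half-open intervals, and these
    determine the measure. *)
Lemma lebesgue_measure_shift (c : R) (A : set R) : measurable A ->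
  mu (shift c @^-1` A) = mu A.
Proof.
move=> mA.
have mshift : measurable_fun setT (shift c : measurableTypeR R -> measurableTypeR R).
  by apply: measurable_funD => //; exact: measurable_cst.
have nu_ocitv X : ocitv X ->
    mu X = pushforward mu (shift c : measurableTypeR R -> measurableTypeR R) X.
  move=> /ocitvP[->|[[a b] /= ab ->]]; first by rewrite /pushforward preimage_set0.
  rewrite /pushforward (_ : _ @^-1` _ = `]a - c, b - c]%classic); last first.
    by apply/seteqP; split => x /=; rewrite !in_itv/= ltrBlDr lerBrDr.
  by rewrite !lebesgue_measure_itv/= !lte_fin ltrD2r; case: ifP => // _;
    rewrite -!EFinB; congr (_%:E); ring.
exact: esym (lebesgue_measure_unique nu_ocitv mA).
Qed.

Lemma negligible_shift (c : R) (N : set R) :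
  mu.-negligible N -> mu.-negligible (shift c @^-1` N).
Proof.
move=> [A [mA A0 NA]]; exists (shift c @^-1` A); split.
- rewrite -[X in measurable X]setTI.
  have : measurable_fun setT (shift c : measurableTypeR R -> measurableTypeR R).
    by apply: measurable_funD => //; exact: measurable_cst.
  exact.
- by rewrite lebesgue_measure_shift.
- by move=> x /NA.
Qed.

Lemma ae_shift (c : R) (P : set R) :
  {ae mu, forall t, P t} -> {ae mu, forall t, P (t + c)}.
Proof. by move=> /(negligible_shift c). Qed.

Lemma ae_imply (P Q : set R) : {ae mu, forall t, P t} ->
  (forall t, P t -> Q t) -> {ae mu, forall t, Q t}.
Proof. by move=> aeP PQ; apply: negligibleS aeP => t /= nQ Pt; exact/nQ/PQ. Qed.

Lemma ae_imply2 (P Q S : set R) : {ae mu, forall t, P t} -> {ae mu, forall t, Q t} ->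
  (forall t, P t -> Q t -> S t) -> {ae mu, forall t, S t}.
Proof.
move=> aeP aeQ PQS; apply: negligibleS (negligibleU aeP aeQ) => t /= nS.
by apply: contrapT => /not_orP[/contrapT Pt /contrapT Qt]; exact/nS/PQS.
Qed.

Lemma negligible_open_cover (N : set R) (e : R) : mu.-negligible N -> 0 < e ->
  exists U : set R, [/\ open U, N `<=` U & (mu U <= e%:E)%E].
Proof.
move=> /negligible_outer_measure N0 e0.
by have [U [oU NU]] := outer_measure_open_le N e0; rewrite N0 add0e => ?; exists U.
Qed.

Lemma sum_length_le (U : set R) (e : R) (l : nat) (s t : 'I_l -> R) :
  open U -> (mu U <= e%:E)%E ->
  (forall i, s i <= t i) -> (forall i, `[s i, t i] `<=` U) ->
  (forall i j, i != j -> t i <= s j \/ t j <= s i) ->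
  \sum_(i < l) (t i - s i) <= e.
Proof.
move=> oU Ue st sU dis; rewrite -lee_fin -sumEFin.
(* Open intervals are used because the closed ones may share endpoints or be reduced to a point. *)
have -> : (\sum_(i < l) (t i - s i)%:E)%E = (\sum_(i < l) mu `]s i, t i[%classic)%E.
  apply: eq_bigr => i _; rewrite /= lebesgue_measure_itv/= lte_fin.
  by case: ltP => // ts; rewrite (le_anti (introT andP (conj ts (st i)))) subrr.
rewrite -(@measure_semi_additive_ord _ _ _ (@lebesgue_measure R) _
  (fun i => `]s i, t i[%classic)) //.
- apply: le_trans Ue; apply: le_measure; rewrite ?inE.
  + by apply: bigsetU_measurable => i _; exact: measurable_itv.
  + exact: open_measurable.
  + elim/big_ind : _ => [|X Y XU YU x [/XU|/YU]|i _ x xi] //.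
    by apply: (sU i); exact: subset_itv_oo_cc.
- move=> i j _ _ [x [/= xi xj]]; apply/eqP/negPn/negP => ij.
  move: xi xj; rewrite !in_itv/= => /andP[six xti] /andP[sjx xtj].
  have [h|h] := dis _ _ ij.
    by have := lt_trans (lt_le_trans xti h) sjx; rewrite ltxx.
  by have := lt_trans (lt_le_trans xtj h) six; rewrite ltxx.
- by apply: bigsetU_measurable => i _; exact: measurable_itv.
Qed.

End NullSets.

(** * Absolutely continuous functions *)

Section AbsolutelyContinuous.
Context {R : realType}.
Implicit Types (a b : R) (g : R -> R).

(** Apply the step at the supremum of the points where [P] holds. It passes from the left of [x] to
    the right without asking for [P x], since at a supremum [P] is only known at points arbitrarily
    close from below. *)
Lemma real_induction (P : R -> Prop) a b : a <= b -> P a ->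
  (forall x, a <= x <= b -> exists2 r : R, 0 < r & forall y1 y2,
     a <= y1 <= x -> x <= y2 <= b -> x - r < y1 -> y2 < x + r -> P y1 -> P y2) ->
  P b.
Proof.
move=> ab Pa step; pose E := [set x | a <= x <= b /\ P x].
have Ea : E a by split => //; rewrite lexx.
have Eub : ubound E b by move=> x [/andP[]].
have hsE : has_sup E by split; [exists a|exists b].
have sE := sup_upper_bound hsE.
have as_ : a <= sup E by exact: sE.
have sb : sup E <= b by apply: ge_sup => //; exists a.
have /step[r r0 {}step] : a <= sup E <= b by rewrite as_.
have [y1 [/andP[ay1 y1b] Py1] sy1] := sup_adherent r0 hsE.
have y1s : y1 <= sup E by apply: sE; split => //; rewrite ay1.
have [bs|sb'] := leP b (sup E + r / 2).
  by apply: (step y1 b) => //; [rewrite ay1|rewrite sb lexx|lra].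
have : sup E + r / 2 <= sup E.
  apply: sE; split; first by lra.
  by apply: (step y1) => //; lra.
lra.
Qed.

(** [abs_continuous] with the norm of any normed module, so that real functions built from a
    trajectory, such as a squared distance, are covered as well. *)
Definition ac_fun {V : normedModType R} a b (g : R -> V) : Prop :=
  forall e : R, 0 < e -> exists2 d : R, 0 < d &
    forall (l : nat) (s t : 'I_l -> R),
      (forall i, [/\ a <= s i, s i <= t i & t i <= b]) ->
      (forall i j, i != j -> t i <= s j \/ t j <= s i) ->
      \sum_(i < l) (t i - s i) < d ->
      \sum_(i < l) `|g (t i) - g (s i)| < e.

(* The exceptional null set lies in an open set U of small measure; along U the
   variation of g is small by absolute continuity, and elsewhere the derivative
   controls the increments. L lists the intervals inside U used so far, the
   most recent first. *)
Lemma ac_fun_nonincreasing a b g : a <= b -> ac_fun (V := R^o) a b g ->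
  {ae @lebesgue_measure R, forall t, a <= t <= b ->
     exists2 d : R, is_derive (t : R^o) (1 : R^o) (g : R^o -> R^o) d & d <= 0} ->
  g b <= g a.
Proof.
move=> ab acg dg; apply/ler_addgt0Pr => e' e'0.
(* The total error is [e] per unit of time off [U] plus [e] for the variation along [U], that is
   [e * (b - a) + e = e']. *)
pose e := e' / (b - a + 1).
have ba1 : 0 < b - a + 1 by lra.
have e0 : 0 < e by rewrite divr_gt0.
have eE : e * (b - a) + e = e' by rewrite /e; field; rewrite gt_eqF.
have [d d0 dP] := acg e e0.
have d20 : 0 < d / 2 by lra.
have [U [oU NU Ud]] := negligible_open_cover dg d20.
pose ok x (p : R * R) := [/\ a <= p.1, p.1 <= p.2, p.2 <= x & `[p.1, p.2] `<=` U].
pose good x := exists L : seq (R * R), [/\ forall p, p \in L -> ok x p,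
  pairwise (fun p q : R * R => q.2 <= p.1) L &
  g x - g a <= e * (x - a) + \sum_(p <- L) `|g p.2 - g p.1| ].
suff [L [Lok Lpw Lb]] : good b.
  have : \sum_(p <- L) `|g p.2 - g p.1| < e.
    rewrite (big_nth (0, 0)) big_mkord.
    pose s (i : 'I_(size L)) := (nth (0, 0) L i).1.
    pose t (i : 'I_(size L)) := (nth (0, 0) L i).2.
    have okst i : [/\ a <= s i, s i <= t i, t i <= b & `[s i, t i] `<=` U].
      exact/Lok/mem_nth.
    have dis i j : i != j -> t i <= s j \/ t j <= s i.
      move/(pairwiseP (0, 0)) : Lpw => Lpw; rewrite neq_ltn => /orP[ij|ji].
        by right; apply: Lpw; rewrite ?inE.
      by left; apply: Lpw; rewrite ?inE.
    apply: (dP _ s t) => //; first by move=> i; have [] := okst i.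
    apply: (@le_lt_trans _ _ (d / 2)); last by lra.
    by apply: (sum_length_le oU) => // i; have [] := okst i.
  lra.
apply: (real_induction ab).
  by exists [::]; split => //; rewrite big_nil; lra.
move=> x axb; have [xU|xU] := pselect (U x).
  have /nbhs_ballP[r /= r0 rU] : nbhs x U by exact: open_nbhs_nbhs.
  exists r => // y1 y2 /andP[ay1 y1x] /andP[xy2 y2b] y1r y2r [L [Lok Lpw Lb]].
  exists ((y1, y2) :: L); split.
  - move=> p; rewrite inE => /orP[/eqP ->|/Lok[? ? ? ?]]; last first.
      by split => //; lra.
    split => //=; first lra.
    move=> z /=; rewrite in_itv/= => /andP[y1z zy2]; apply: rU.
    by rewrite /ball/= ltr_distlC; apply/andP; split; lra.
  - rewrite /= Lpw andbT; apply/allP => p /Lok[? ? ? ?] /=; lra.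
  - rewrite big_cons/=.
    have := ler_norm (g y2 - g y1).
    have : e * (y1 - a) <= e * (y2 - a) by rewrite ler_pM2l//; lra.
    lra.
have [D gD D0] : exists2 d : R,
    is_derive (x : R^o) (1 : R^o) (g : R^o -> R^o) d & d <= 0.
  by apply: contra_notP xU => xD; apply: NU => /(_ axb).
have [r r0 rP] := (is_derive_epsP _ _ _ _).1 gD e e0.
have {}rP y : `|y - x| < r -> `|g y - g x - (y - x) * D| <= e * `|y - x|.
  by move=> /rP /=; rewrite [_ *: 1]mulr1 subrK.
exists r => // y1 y2 /andP[ay1 y1x] /andP[xy2 y2b] y1r y2r [L [Lok Lpw Lb]].
exists L; split => //; first by move=> p /Lok[? ? ? ?]; split => //; lra.
(* Straddle estimate: as [y1 <= x <= y2] and [D <= 0], the bounds on the two sides of [x] add up to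
   an increment of at most [e * (y2 - y1)]. *)
have /rP : `|y1 - x| < r by rewrite ltr_norml; lra.
have /rP : `|y2 - x| < r by rewrite ltr_norml; lra.
rewrite (ger0_norm (_ : 0 <= y2 - x)) ?subr_ge0//.
rewrite (ler0_norm (_ : y1 - x <= 0)) ?subr_le0//.
rewrite !ler_norml => /andP[_ h2] /andP[h1 _].
have : (y2 - x) * D <= 0 by rewrite mulr_ge0_le0 ?subr_ge0.
have : 0 <= (y1 - x) * D by rewrite mulr_le0 ?subr_le0.
lra.
Qed.

End AbsolutelyContinuous.

(** * Euclidean projections and faces *)

Section EuclideanSpace.
Context {R : realType} {k : nat}.
Implicit Types (u v w p q d : 'cV[R]_k) (K C F N W S : set 'cV[R]_k) (M : 'M[R]_k).

Lemma dotE u v : dot u v = \sum_i u i 0 * v i 0.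
Proof. by rewrite /dot mxE; apply: eq_bigr => i _; rewrite mxE. Qed.

Lemma dotC u v : dot u v = dot v u.
Proof. by rewrite !dotE; apply: eq_bigr => i _; rewrite mulrC. Qed.

Lemma dotDl u v w : dot (u + v) w = dot u w + dot v w.
Proof. by rewrite /dot raddfD/= mulmxDl mxE. Qed.

Lemma dotZl a u v : dot (a *: u) v = a * dot u v.
Proof. by rewrite /dot linearZ/= -scalemxAl mxE. Qed.

Lemma dotNl u v : dot (- u) v = - dot u v.
Proof. by rewrite -scaleN1r dotZl mulN1r. Qed.

Lemma dotBl u v w : dot (u - v) w = dot u w - dot v w.
Proof. by rewrite dotDl dotNl. Qed.

Lemma dotDr u v w : dot u (v + w) = dot u v + dot u w.
Proof. by rewrite dotC dotDl !(dotC u). Qed.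

Lemma dotZr a u v : dot u (a *: v) = a * dot u v.
Proof. by rewrite dotC dotZl (dotC u). Qed.

Lemma dotNr u v : dot u (- v) = - dot u v.
Proof. by rewrite dotC dotNl (dotC u). Qed.

Lemma dotBr u v w : dot u (v - w) = dot u v - dot u w.
Proof. by rewrite dotDr dotNr. Qed.

Lemma dot0l v : dot 0 v = 0.
Proof. by rewrite -(scale0r 0) dotZl mul0r. Qed.

Lemma dot0r v : dot v 0 = 0.
Proof. by rewrite dotC dot0l. Qed.

Definition dot_lin :=
  (dotDl, dotBl, dotDr, dotBr, dotZl, dotZr, dotNl, dotNr, dot0l, dot0r).

Lemma dot_suml (I : Type) (r : seq I) (P : pred I) (f : I -> 'cV[R]_k) v :
  dot (\sum_(i <- r | P i) f i) v = \sum_(i <- r | P i) dot (f i) v.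
Proof.
by elim/big_rec2 : _ => [|i x y _ <-]; rewrite ?dot0l ?dotDl.
Qed.

Lemma dot_sqr_ge0 u : 0 <= dot u u.
Proof. by rewrite dotE sumr_ge0// => i _; rewrite -expr2 sqr_ge0. Qed.

Lemma coord_sqr_le_dot u i : u i 0 ^+ 2 <= dot u u.
Proof.
rewrite dotE (bigD1 i)//= -expr2 lerDl sumr_ge0// => j _.
by rewrite -expr2 sqr_ge0.
Qed.

Lemma dot_sqr_eq0 u : dot u u = 0 -> u = 0.
Proof.
move=> u0; apply/matrixP => i j; rewrite ord1 mxE; apply/eqP.
by rewrite -sqrf_eq0 eq_le sqr_ge0 andbT -u0 coord_sqr_le_dot.
Qed.

Lemma dot_mulmxl M u v : dot (M *m u) v = dot u (M^T *m v).
Proof. by rewrite /dot trmx_mul mulmxA. Qed.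

Lemma mx_norm_leP {n m} (A : 'M[R]_(n, m)) (c : R) : 0 <= c ->
  (forall i j, `|A i j| <= c) -> `|A| <= c.
Proof.
move=> c0 Ac; rewrite -[`|A|]/(mx_norm A) mx_normrE.
by apply/bigmax_leP; split => // i _; exact: Ac.
Qed.

Lemma coord_le_norm {n m} (A : 'M[R]_(n, m)) i j : `|A i j| <= `|A|.
Proof.
rewrite -[`|A|]/(mx_norm A) mx_normrE.
exact: (le_bigmax _ (fun ij : 'I_n * 'I_m => `|A ij.1 ij.2|) (i, j)).
Qed.

Lemma norm_trmx {n m} (A : 'M[R]_(n, m)) : `|A^T| = `|A|.
Proof.
suff H n' m' (B : 'M[R]_(n', m')) : `|B^T| <= `|B|.
  by apply/eqP; rewrite eq_le H -{1}(trmxK A) H.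
by apply: mx_norm_leP => // i j; rewrite mxE coord_le_norm.
Qed.

Lemma norm_sqr_le_dot u : `|u| ^+ 2 <= dot u u.
Proof.
rewrite -(sqr_sqrtr (dot_sqr_ge0 u)) lerXn2r ?nnegrE ?sqrtr_ge0//.
apply: mx_norm_leP => [|i j]; first exact: sqrtr_ge0.
by rewrite ord1 -sqrtr_sqr ler_wsqrtr// coord_sqr_le_dot.
Qed.

Lemma norm_le_enorm u : `|u| <= enorm u.
Proof.
by rewrite -[leLHS]ger0_norm// -sqrtr_sqr ler_wsqrtr// norm_sqr_le_dot.
Qed.

Lemma norm_mulmx_le {l n m} (A : 'M[R]_(l, n)) (B : 'M[R]_(n, m)) :
  `|A *m B| <= n%:R * (`|A| * `|B|).
Proof.
apply: mx_norm_leP => [|i j]; first by rewrite !mulr_ge0.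
rewrite mxE (le_trans (ler_norm_sum _ _ _))//.
rewrite -[n in n%:R]card_ord -sum1_card natr_sum mulr_suml ler_sum// => h _.
by rewrite mul1r normrM ler_pM// coord_le_norm.
Qed.

Lemma norm_dot_le u v : `|dot u v| <= k%:R * (`|u| * `|v|).
Proof.
by rewrite (le_trans (coord_le_norm _ _ _))// (le_trans (norm_mulmx_le _ _))// norm_trmx.
Qed.

Lemma dot_sqr_le_norm u : dot u u <= k%:R * `|u| ^+ 2.
Proof. by rewrite expr2 -[leLHS]ger0_norm ?dot_sqr_ge0// norm_dot_le. Qed.

Lemma continuous_coord_sum (f g : 'I_k -> 'cV[R]_k -> R) :
  (forall i, continuous (f i)) -> (forall i, continuous (g i)) ->
  continuous (fun u => \sum_i f i u * g i u).
Proof.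
move=> cf cg; apply: (continuous_big (@add_continuous R^o)) => i _ u.
exact: (cvgM (cf i u) (cg i u)).
Qed.

Lemma continuous_dotr u : continuous (fun v => dot u v : R^o).
Proof.
move=> v; under eq_fun do rewrite dotE.
apply: (@continuous_coord_sum (fun i => cst (u i 0)) (fun i v => v i 0)) => i.
  exact: cst_continuous.
exact: coord_continuous.
Qed.

Lemma continuous_dist_sqr u : continuous (fun v => dot (v - u) (v - u) : R^o).
Proof.
move=> v; under eq_fun do rewrite dotE.
have cc i : continuous (fun w => (w - u) i 0 : R).
  rewrite (_ : (fun w => _) = fun w => w i 0 - u i 0) => [w|]; last first.
    by apply/funext => w; rewrite !mxE.
  exact: (cvgB (@coord_continuous _ _ _ i 0 w) (cvg_cst _)).
exact: (@continuous_coord_sum (fun i w => (w - u) i 0) (fun i w => (w - u) i 0)).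
Qed.

Lemma convex_setP C : convex_set C <-> forall u v (t : R), C u -> C v ->
  0 <= t -> t <= 1 -> C (t *: u + (1 - t) *: v).
Proof.
split=> [cC u v t Cu Cv t0 t1|H u v t /set_mem Cu /set_mem Cv].
  by have /set_mem := cC u v (Itv01 t0 t1) (mem_set Cu) (mem_set Cv).
by apply/mem_set/H.
Qed.

(** Heine-Borel for row vectors, carried over by transposition, which preserves the norm. *)
Lemma bounded_closed_compact_cV C (B : R) :
  (forall u, C u -> `|u| <= B) -> closed C -> compact C.
Proof.
move=> CB clC.
have ct m n : continuous (@trmx R m n).
  move=> A; apply/continuous_epsP => e e0; exists e => // A' AA'.
  by rewrite -raddfB norm_trmx.
pose C' : set 'rV[R]_k := (fun r : 'rV[R]_k => r^T) @^-1` C.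
have -> : C = trmx @` C'.
  apply/seteqP; split => [u Cu|_ [v Cv <-] //].
  by exists u^T; rewrite /C' ?trmxK//= trmxK.
apply: continuous_compact; first exact/continuous_subspaceT/ct.
apply: bounded_closed_compact.
  exists B; split; first exact: num_real.
  move=> x Bx v /CB vB; rewrite /= -norm_trmx.
  exact: le_trans vB (ltW Bx).
by apply: closed_comp clC => r _; exact: ct.
Qed.

(** Only the points of [C] at least as close to [u] as a given one compete, and they form a compact
    set. *)
Lemma exists_nearest C u : closed C -> C !=set0 ->
  exists2 p, C p & forall q, C q -> dot (p - u) (p - u) <= dot (q - u) (q - u).
Proof.
move=> clC [q0 Cq0]; pose D := dot (q0 - u) (q0 - u).
pose C' := C `&` [set q | dot (q - u) (q - u) <= D].
have cC' : compact C'.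
  apply: (@bounded_closed_compact_cV _ (`|u| + Num.sqrt D)).
    move=> q [_ qD]; rewrite -(subrK u q) (le_trans (ler_normD _ _))// addrC.
    by rewrite lerD2l (le_trans (norm_le_enorm _))// ler_wsqrtr.
  apply: closedI => //.
  apply: (@closed_comp _ _ (fun q => dot (q - u) (q - u) : R^o) [set x | x <= D]).
    by move=> q _; exact: continuous_dist_sqr.
  exact: closed_le.
have C'0 : C' !=set0 by exists q0; split => /=.
have [p /set_mem[Cp pD] pmin] := compact_EVT_min C'0 cC'
  (continuous_subspaceT (@continuous_dist_sqr u)).
exists p => // q Cq; have [qD|/ltW Dq] := leP (dot (q - u) (q - u)) D.
  by apply: pmin; exact/mem_set.
exact: le_trans pD Dq.
Qed.

Lemma quadratic_ge0 (a b : R) :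
  (forall t, 0 < t -> t <= 1 -> 0 <= t * b + t ^+ 2 * a) -> 0 <= b.
Proof.
move=> H; rewrite leNgt; apply/negP => b0.
have a0 : 0 < a by have := H 1 ltr01 (lexx _); lra.
(* Half the positive root of [t * b + t ^+ 2 * a], capped at 1: there the negative linear term still
   dominates. *)
pose t := Num.min 1 (- b / (2 * a)).
have t0 : 0 < t by rewrite lt_min ltr01 divr_gt0//; lra.
have t1 : t <= 1 by rewrite ge_min lexx.
have ta : t * a <= - b / 2.
  have : t <= - b / (2 * a) by rewrite ge_min lexx orbT.
  rewrite -(ler_pM2r a0) => /le_trans; apply.
  by rewrite le_eqVlt; apply/orP; left; apply/eqP; field; rewrite gt_eqF.
have := H t t0 t1; rewrite expr2 -mulrA -mulrDr pmulr_rge0//; lra.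
Qed.

Lemma nearest_obtuse C u p : convex_set C -> C p ->
  (forall q, C q -> dot (p - u) (p - u) <= dot (q - u) (q - u)) ->
  forall q, C q -> 0 <= dot (p - u) (q - p).
Proof.
move=> /convex_setP cC Cp pmin q Cq.
apply: (@quadratic_ge0 (dot (q - p) (q - p) / 2)) => t t0 t1.
have := pmin _ (cC _ _ _ Cq Cp (ltW t0) t1).
have -> : t *: q + (1 - t) *: p - u = (p - u) + t *: (q - p).
  by apply/matrixP => i j; rewrite !mxE; ring.
rewrite [in leRHS]dotDl !(dotDr _ (p - u)) !dotZl !dotZr (dotC (q - p)); lra.
Qed.

Section Projection.
Variable N : set 'cV[R]_k.
Local Notation W := (orth_compl N).
Local Notation Pi := (projection_mx W).

Lemma orth_compl_lin a u v : W u -> W v -> W (a *: u + v).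
Proof. by move=> Wu Wv w Nw; rewrite !dot_lin Wu// Wv// mulr0 addr0. Qed.

Lemma closed_orth_compl : closed W.
Proof.
have -> : W = \bigcap_(w in N) ((fun u => dot w u : R^o) @^-1` [set 0]).
  by apply/seteqP; split => u Wu w Nw; rewrite /= dotC; exact: Wu.
apply: closed_bigI => w _; apply: closed_comp => [u _|].
  exact: continuous_dotr.
exact: closed_eq.
Qed.

Lemma enorm_le u v : (enorm u <= enorm v) = (dot u u <= dot v v).
Proof. by rewrite /enorm ler_psqrt ?nnegrE ?dot_sqr_ge0. Qed.

Lemma euclid_proj_orth_compl u : W (euclid_proj W u) /\
  forall w, W w -> dot (u - euclid_proj W u) w = 0.
Proof.
have W0 : W 0 by move=> w _; rewrite dot0l.
have [p Wp pmin] := exists_nearest u closed_orth_compl (ex_intro _ 0 W0).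
rewrite /euclid_proj; case: xgetP => [p' _ [Wp' p'min]|]; last first.
  move=> /(_ p) []; split => // q Wq.
  by rewrite enorm_le -opprB -(opprB q) !dotNl !dotNr !opprK pmin.
split => // w Ww; have cW : convex_set W.
  apply/convex_setP => a b t Wa Wb _ _; apply: orth_compl_lin => //.
  by rewrite -[_ *: b]addr0; exact: orth_compl_lin.
have obt := @nearest_obtuse W u p' cW Wp' _.
have {}obt q : W q -> 0 <= dot (p' - u) (q - p').
  apply: obt => q' /p'min.
  by rewrite enorm_le -opprB -(opprB q') !dotNl !dotNr !opprK.
(* In a subspace the obtuse angle inequality can be tested at [p' + w] and at [p' - w], hence it is
   an equality. *)
have := obt _ (orth_compl_lin 1 Ww Wp'); have := obt _ (orth_compl_lin (-1) Ww Wp').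
rewrite scaleN1r scale1r !addrK -opprB !dotNl !dotNr; lra.
Qed.

Lemma projection_mxE u : Pi *m u = \sum_j u j 0 *: euclid_proj W (delta_mx j 0).
Proof.
apply/matrixP => i j; rewrite ord1 summxE mxE; apply: eq_bigr => l _.
by rewrite !mxE mulrC.
Qed.

Lemma projection_mx_in u : W (Pi *m u).
Proof.
rewrite projection_mxE; elim/big_ind : _ => [w _|a b Wa Wb|j _].
- by rewrite dot0l.
- by rewrite -(scale1r a); exact: orth_compl_lin.
- rewrite -[_ *: _]addr0; apply: orth_compl_lin.
    by have [] := euclid_proj_orth_compl (delta_mx j 0).
  by move=> w _; rewrite dot0l.
Qed.

(** [Pi] is given by its columns and so is linear by construction; orthogonality of the residual
    only has to be read on basis vectors. *)
Lemma projection_mx_dot u w : W w -> dot (Pi *m u) w = dot u w.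
Proof.
move=> Ww; rewrite projection_mxE {2}(matrix_sum_delta u) !dot_suml.
apply: eq_bigr => i _; rewrite big_ord1 !dotZl; congr (_ * _).
have [_ /(_ _ Ww)] := euclid_proj_orth_compl (delta_mx i 0).
by rewrite dotBl => /eqP; rewrite subr_eq0 => /eqP ->.
Qed.

Lemma projection_mx_id w : W w -> Pi *m w = w.
Proof.
move=> Ww; apply/eqP; rewrite -subr_eq0; apply/eqP/dot_sqr_eq0.
have WPw : W (Pi *m w - w).
  by rewrite addrC -scaleN1r; apply: orth_compl_lin => //; exact: projection_mx_in.
by rewrite {1}dotBl projection_mx_dot// subrr.
Qed.

Lemma projection_mx_eq0 d : (forall w, W w -> dot d w = 0) -> Pi *m d = 0.
Proof.
move=> dW; apply: dot_sqr_eq0; rewrite projection_mx_dot ?dW//;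
  exact: projection_mx_in.
Qed.

End Projection.

Section MinimalFace.
Variables K S : set 'cV[R]_k.
Hypotheses (cK : convex_set K) (SK : S `<=` K) (S0 : S 0).
Local Notation F := (minimal_face K S).
Local Notation N := (affine_normal_cone (affine_span F)).
Local Notation W := (orth_compl N).

Lemma sub_minimal_face : S `<=` F.
Proof. by move=> s Ss G [_ SG]; exact: SG. Qed.

Lemma sub_affine_span (G : set 'cV[R]_k) : G `<=` affine_span G.
Proof.
move=> g Gg; exists 1%N, (fun=> 1), (fun=> g); split => //.
  by rewrite big_ord1.
by rewrite big_ord1 scale1r.
Qed.

(** A normal vector of the span obeys its inequality from 0 to [w] and from [w] to 0, which lies in
    [F] because it lies in [S]; the two inequalities are opposite. *)
Lemma minimal_face_sub_orth : F `<=` W.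
Proof.
move=> w Fw d Nd; have F0 : F 0 by exact: sub_minimal_face.
have := Nd _ (sub_affine_span F0) _ (sub_affine_span Fw).
have := Nd _ (sub_affine_span Fw) _ (sub_affine_span F0).
rewrite !dot_lin dotC; lra.
Qed.

Lemma minimal_face_segment u v (t : R) : K u -> K v -> 0 < t -> t < 1 ->
  F ((1 - t) *: u + t *: v) -> F u.
Proof.
move=> Ku Kv t0 t1 Fc G [[GK cG faceG] SG].
have /convex_setP cK' := cK.
apply: (faceG u v); first last.
- by exists 0; rewrite /= ?in_itv/= ?lexx ?ler01// subr0 scale1r scale0r addr0.
- exists ((1 - t) *: u + t *: v); split; last exact: Fc.
  by exists t => //=; rewrite in_itv/= t0.
- move=> _ [s /= + <-]; rewrite in_itv/= => /andP[s0 s1].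
  by rewrite -{2}(subKr 1 s); apply: cK' => //; rewrite ?subr_ge0// gerBl.
Qed.

(** A combination of two nonnegative numbers with positive weights vanishes only if both do. Hence a
    segment of [K] whose relative interior meets the hyperplane has both ends in it. *)
Lemma exposed_face d : (forall w, K w -> 0 <= dot d w) ->
  face K (K `&` [set w | dot d w = 0]).
Proof.
move=> dK; have /convex_setP cK' := cK; split => [w []//||u v suv].
  apply/convex_setP => u v t [Ku /= du] [Kv /= dv] t0 t1; split.
    exact: cK'.
  by rewrite /= !dot_lin du dv !mulr0 addr0.
have [Ku Kv] : K u /\ K v.
  split; apply: suv; [exists 0|exists 1] => /=;
    by rewrite ?in_itv/= ?lexx ?ler01// ?subr0 ?subrr scale1r scale0r ?add0r ?addr0.
have [du dv] := (dK _ Ku, dK _ Kv).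
move=> [_ [[t /= + <-] [_ /=]]]; rewrite in_itv/= => /andP[t0 t1].
rewrite !dot_lin => tE.
have du0 : dot d u = 0.
  apply/eqP; rewrite eq_le du andbT.
  rewrite -(pmulr_rle0 _ (_ : 0 < 1 - t)) ?subr_gt0//.
  have := mulr_ge0 (ltW t0) dv; lra.
have dv0 : dot d v = 0.
  apply/eqP; rewrite eq_le dv andbT -(pmulr_rle0 _ t0).
  by rewrite du0 in tE; lra.
move=> _ [s + <-] => sI; split; first by apply: suv; exists s.
by rewrite /= !dot_lin du0 dv0 !mulr0 addr0.
Qed.

(** The only way in which minimality of the face is used to annihilate vectors: the face exposed by
    [d] contains [S], hence [F], so [d] is orthogonal to the span and belongs to its normal cone, on
    which [Pi] vanishes. *)
Lemma projection_mx_exposed d : (forall w, K w -> 0 <= dot d w) ->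
  (forall s, S s -> dot d s = 0) -> projection_mx W *m d = 0.
Proof.
move=> dK dS; have FG : F `<=` [set w | dot d w = 0].
  move=> w /(_ (K `&` [set w | dot d w = 0])) [] //.
  by split; [exact: exposed_face|move=> s Ss; split; [exact: SK|exact: dS]].
apply: projection_mx_eq0 => w Ww; rewrite dotC; apply: Ww => z Vz z' Vz'.
suff dV x : affine_span F x -> dot d x = 0 by rewrite dotBr !dV ?subrr.
move=> [l [c [s [Fs _ ->]]]]; rewrite dotC dot_suml big1// => i _.
by rewrite dotZl dotC FG ?mulr0.
Qed.

End MinimalFace.

End EuclideanSpace.

(** * Directional derivatives *)

Section Directional.
Context {R : realType} {V : normedModType R}.
Implicit Types (f g : V -> R^o) (x u v w : V).

Lemma is_derive_line f x v (s d : R) : is_derive (x + s *: v) v f d ->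
  is_derive (s : R^o) (1 : R^o) (fun t : R^o => f (x + t *: v)) d.
Proof.
move=> /is_derive_epsP H; apply/is_derive_epsP => e e0.
have [r r0 rP] := H e e0; exists r => // h hr.
by rewrite [h *: 1]mulr1 scalerDl addrCA; exact: rP.
Qed.

Lemma is_derive_translate {V' : normedModType R} (f : V -> V') x v w (d : V') :
  is_derive (x + w) v f d -> is_derive x v (fun y => f (y + w)) d.
Proof.
move=> /is_derive_epsP H; apply/is_derive_epsP => e e0.
have [r r0 rP] := H e e0; exists r => // h hr.
by rewrite /= -(addrA (h *: v)); exact: rP.
Qed.

Lemma is_derive_scale_dir f x v (c d : R) : is_derive x v f d ->
  is_derive x (c *: v) f (c * d).
Proof.
move=> /is_derive_epsP H; have [->|c0] := eqVneq c 0.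
  by rewrite scale0r mul0r; exact: is_derive0.
apply/is_derive_epsP => e e0; have ac0 : 0 < `|c| by rewrite normr_gt0.
have [r r0 rP] := H (e / `|c|) (divr_gt0 e0 ac0).
exists (r / `|c|) => [|h]; first exact: divr_gt0.
rewrite ltr_pdivlMr// -normrM => /rP.
rewrite scalerA -[h *: (c * d)]/(h * (c * d)) mulrA => /le_trans; apply.
by rewrite normrM (mulrC `|h|) mulrA divfK ?gt_eqF.
Qed.

Lemma MVT_line f g x v (h : R) :
  (forall s, `|s| <= `|h| -> is_derive (x + s *: v) v f (g (x + s *: v))) ->
  exists2 s : R, `|s| <= `|h| & f (x + h *: v) - f x = h * g (x + s *: v).
Proof.
move=> fg; pose F (t : R^o) : R^o := f (x + t *: v).
have dF s : `|s| <= `|h| -> is_derive (s : R^o) (1 : R^o) F (g (x + s *: v)).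
  by move=> /fg; exact: is_derive_line.
have F0 : F 0 = f x by rewrite /F scale0r addr0.
have cF a b : (forall s, a <= s <= b -> `|s| <= `|h|) ->
    {within `[a, b], continuous F}.
  move=> ab; apply: derivable_within_continuous => s; rewrite in_itv/= => /ab.
  by move=> /dF[].
have [h0|h0] := leP 0 h.
- have sh s : 0 <= s <= h -> `|s| <= `|h|.
    by move=> /andP[s0 sh]; rewrite !ger0_norm.
  have [s|s sh' FE] := @MVT_segment R F (fun s => g (x + s *: v)) 0 h h0 _ (cF _ _ sh).
    by rewrite in_itv/= => /andP[s0 s1]; apply/dF/sh; rewrite !ltW.
  exists s; first by apply: sh; move: sh'; rewrite in_itv.
  by rewrite -F0 FE subr0 mulrC.
- have sh s : h <= s <= 0 -> `|s| <= `|h|.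
    by move=> /andP[s0 sh]; rewrite !ler0_norm ?lerN2// ltW.
  have [s|s sh' FE] := @MVT_segment R F (fun s => g (x + s *: v)) h 0 (ltW h0) _ (cF _ _ sh).
    by rewrite in_itv/= => /andP[s0 s1]; apply/dF/sh; rewrite !ltW.
  exists s; first by apply: sh; move: sh'; rewrite in_itv.
  by rewrite -F0 -opprB FE sub0r mulrN opprK mulrC.
Qed.

(** The roles of [u] and [v] differ so that directions can be added one by one: the derivative along
    [u] is known at [x] only, while the increment along [v], taken from [h *: u + x], is controlled
    by the mean value theorem and continuity of [g]. *)
Lemma is_derive_add_dir f g x u v (a : R) : is_derive x u f a ->
  (exists2 r : R, 0 < r & forall w, `|w - x| < r -> is_derive w v f (g w)) ->
  {for x, continuous g} -> is_derive x (u + v) f (a + g x).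
Proof.
move=> /is_derive_epsP fu [r r0 fv] /continuous_epsP gx.
apply/is_derive_epsP => e e0; have e20 : 0 < e / 2 by lra.
have [d1 d10 d1P] := fu _ e20; have [d2 d20 d2P] := gx _ e20.
pose c := `|u| + `|v| + 1.
have c0 : 0 < c by rewrite /c ltr_wpDl ?addr_ge0.
exists (Num.min d1 (Num.min (r / c) (d2 / c))) => [|h].
  by rewrite !lt_min d10 !divr_gt0.
rewrite !lt_min => /and3P[h1]; rewrite !ltr_pdivlMr// => hr h2.
have close s : `|s| <= `|h| -> `|(h *: u + x) + s *: v - x| <= `|h| * c.
  move=> sh; rewrite addrAC addrK (le_trans (ler_normD _ _))// !normrZ.
  have := ler_wpM2r (normr_ge0 v) sh; rewrite /c; have := normr_ge0 h; nra.
have [s sh fE] : exists2 s : R, `|s| <= `|h| &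
    f (h *: u + x + h *: v) - f (h *: u + x) = h * g (h *: u + x + s *: v).
  apply: MVT_line => s /close sc; apply: fv; exact: le_lt_trans sc hr.
have gs := d2P _ (le_lt_trans (close _ sh) h2).
rewrite scalerDr (addrAC (h *: u)).
have arith (A B C G : R) : A - B = h * G ->
    A - C - h * (a + g x) = (B - C - h * a) + h * (G - g x).
  by move=> E; rewrite (mulrBr h G) -E; ring.
rewrite [X in `|X|](arith _ _ (f x) _ fE).
rewrite (le_trans (ler_normD _ _))// normrM.
have := d1P _ h1; have := ler_wpM2l (normr_ge0 h) (ltW gs); lra.
Qed.

Lemma is_derive_le0 f x v (d : R) : is_derive x v f d ->
  (forall t, 0 < t -> t <= 1 -> f (x + t *: v) <= f x) -> d <= 0.
Proof.
move=> /is_derive_epsP H fle; apply/ler_addgt0Pr => e e0; rewrite add0r.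
have [r r0 rP] := H e e0; pose h := Num.min 1 (r / 2).
have h0 : 0 < h by rewrite lt_min ltr01; lra.
have h1 : h <= 1 by rewrite ge_min lexx.
have hr : h <= r / 2 by rewrite ge_min lexx orbT.
have /rP : `|h| < r by rewrite gtr0_norm//; lra.
rewrite (gtr0_norm h0) ler_norml [h *: d]/(h * d) => /andP[+ _].
have arith (A B : R) : A <= B -> - (e * h) <= A - B - h * d -> d <= e.
  move=> c1 c2; suff : h * d <= h * e by rewrite ler_pM2l.
  lra.
by apply: arith; rewrite addrC; exact: fle.
Qed.

Lemma continuous_ray_le f x v (c : R) : {for x, continuous f} ->
  (forall t, 0 < t -> t <= 1 -> f (x + t *: v) <= c) -> f x <= c.
Proof.
move=> /continuous_epsP cf fc; apply/ler_addgt0Pr => e e0.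
have [d d0 dP] := cf e e0; have v0 : 0 < `|v| + 1 by rewrite ltr_wpDl.
pose h := Num.min 1 (d / (`|v| + 1) / 2).
have h0 : 0 < h by rewrite lt_min ltr01 !divr_gt0.
have h1 : h <= 1 by rewrite ge_min lexx.
have hd : h * (`|v| + 1) <= d / 2.
  rewrite -ler_pdivlMr// mulrAC; by rewrite ge_min lexx orbT.
have /dP : `|x + h *: v - x| < d.
  rewrite addrAC subrr add0r normrZ gtr0_norm//; lra.
have arith (a b : R) : `|a - b| < e -> a <= c -> b <= c + e.
  rewrite ltr_norml; lra.
by move=> /arith; apply; exact: fc.
Qed.

End Directional.

Section Gradient.
Context {R : realType} {k : nat}.
Implicit Types (f : 'cV[R]_k -> R) (U : set 'cV[R]_k) (u v w z : 'cV[R]_k).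

Lemma nbhs_norm U z : open U -> U z ->
  exists2 r : R, 0 < r & forall w, `|w - z| < r -> U w.
Proof.
move=> oU Uz; have /nbhs_ballP[r /= r0 rU] : nbhs z U by exact: open_nbhs_nbhs.
by exists r => // w wz; apply: rU; rewrite -ball_normE/= distrC.
Qed.

(** [C1_on] speaks of partial derivatives only; a general direction is assembled by adding one
    coordinate at a time. *)
Lemma is_derive_gradient U f z v : open U -> C1_on U f -> U z ->
  is_derive z v (f : _ -> R^o) (dot (gradient f z) v).
Proof.
move=> oU Uf Uz; rewrite dotE (eq_bigr (fun i => v i 0 * pderiv i f z)); last first.
  by move=> i _; rewrite mxE mulrC.
have vE : v = \sum_i v i 0 *: delta_mx i 0.
  by rewrite {1}(matrix_sum_delta v); apply: eq_bigr => i _; rewrite big_ord1.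
rewrite [X in is_derive _ X]vE.
elim: (index_enum _) => [|i r IH]; first by rewrite !big_nil; exact: is_derive0.
rewrite !big_cons addrC [X in is_derive _ _ _ X]addrC.
pose g w : R^o := v i 0 * pderiv i f w.
have [d d0 dU] := nbhs_norm oU Uz.
apply: (@is_derive_add_dir _ _ _ g) => //.
- exists d => // w /dU Uw; apply: is_derive_scale_dir.
  by have [/derivableP] := Uf _ Uw i.
- exact: (cvgM (cvg_cst (v i 0)) (Uf _ Uz i).2).
Qed.

Lemma dist_lt_half (e p a b : R) : `|p - a| < e / 2 -> `|p - b| < e / 2 ->
  `|a - b| <= e.
Proof.
move=> pa pb; rewrite distrC in pa; rewrite (le_trans (ler_distD p _ _))//.
lra.
Qed.

(** Two applications of the mean value theorem, along [i] and then along [j]. The left side is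
    symmetric in [i] and [j] up to regrouping, so the same difference also evaluates the other mixed
    derivative: this is the classical proof of Schwarz's theorem. *)
Lemma second_difference U f z (i j : 'I_k) (h : R) : C2_on U f ->
  (forall s t : R, `|s| <= `|h| -> `|t| <= `|h| ->
     U (z + s *: delta_mx i 0 + t *: delta_mx j 0)) ->
  exists s t : R, [/\ `|s| <= `|h|, `|t| <= `|h| &
    f (z + h *: delta_mx i 0 + h *: delta_mx j 0) - f (z + h *: delta_mx i 0)
      - (f (z + h *: delta_mx j 0) - f z) =
    h * (h * pderiv j (pderiv i f) (z + s *: delta_mx i 0 + t *: delta_mx j 0))].
Proof.
move=> [Uf Uf'] Uh; set a := delta_mx i 0; set b := delta_mx j 0.
have h00 : `|0 : R| <= `|h| by rewrite normr0.
pose psi w : R^o := f (w + h *: b) - f w.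
pose g w : R^o := pderiv i f (w + h *: b) - pderiv i f w.
have [s sh E1] : exists2 s : R, `|s| <= `|h| &
    psi (z + h *: a) - psi z = h * g (z + s *: a).
  apply: MVT_line => s sh; apply: is_deriveB.
    apply: is_derive_translate.
    by have [/derivableP] := Uf _ (Uh _ _ sh (lexx _)) i.
  by have := Uh _ _ sh h00; rewrite scale0r addr0 => /Uf/(_ i)[/derivableP].
have [t th E2] : exists2 t : R, `|t| <= `|h| &
    pderiv i f (z + s *: a + h *: b) - pderiv i f (z + s *: a) =
    h * pderiv j (pderiv i f) (z + s *: a + t *: b).
  apply: (@MVT_line _ _ (pderiv i f) (pderiv j (pderiv i f))) => t th.
  by have [/derivableP] := Uf' i _ (Uh _ _ sh th) j.
by exists s, t; split => //; rewrite -E2 -E1.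
Qed.

Lemma hessian_sym U f z : open U -> C2_on U f -> U z ->
  (hessian f z)^T = hessian f z.
Proof.
move=> oU Uf Uz; apply/matrixP => j i; rewrite !mxE.
apply/eqP; rewrite -subr_eq0 -normr_le0; apply/ler_addgt0Pr => e e0.
have e20 : 0 < e / 2 by lra.
have [_ Uf'] := Uf.
have [r r0 rU] := nbhs_norm oU Uz.
have [d1 d10 d1P] := (continuous_epsP _ _).1 (Uf' j _ Uz i).2 _ e20.
have [d2 d20 d2P] := (continuous_epsP _ _).1 (Uf' i _ Uz j).2 _ e20.
pose d := Num.min r (Num.min d1 d2).
have d0 : 0 < d by rewrite !lt_min r0 d10.
have nd (l : 'I_k) : `|delta_mx l 0 : 'cV[R]_k| <= 1.
  by apply: mx_norm_leP => // a b; rewrite mxE; case: andP; rewrite ?normr1 ?normr0.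
(* All points of the square of side [h] in either order are within [2 * h < d] of [z]. *)
pose h := d / 4; have h0 : 0 < h by rewrite /h; lra.
have close (l l' : 'I_k) s t : `|s| <= `|h| -> `|t| <= `|h| ->
    `|z + s *: delta_mx l 0 + t *: delta_mx l' 0 - z| < d.
  move=> sh th; rewrite -(addrA z) addrAC subrr add0r (le_lt_trans (ler_normD _ _))//.
  rewrite !normrZ; rewrite (gtr0_norm h0) in sh th.
  have := ler_pM (normr_ge0 _) (normr_ge0 _) sh (nd l).
  have := ler_pM (normr_ge0 _) (normr_ge0 _) th (nd l').
  rewrite !mulr1 /h in sh th *; lra.
have dr w : `|w - z| < d -> [/\ `|w - z| < r, `|w - z| < d1 & `|w - z| < d2].
  by rewrite !lt_min => /and3P[].
have dU w : `|w - z| < d -> U w by move=> /dr[/rU].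
have [s1 [t1 [s1h t1h]]] := second_difference Uf
  (fun s t sh th => dU _ (close i j s t sh th)).
have [s2 [t2 [s2h t2h]]] := second_difference Uf
  (fun s t sh th => dU _ (close j i s t sh th)).
have [_ _ /d2P] := dr _ (close i j _ _ s1h t1h).
have [_ /d1P + _] := dr _ (close j i _ _ s2h t2h).
set p1 := pderiv i _ (_ + _); set p2 := pderiv j _ (_ + _) => P1 P2 E2 E1.
rewrite (addrAC z (h *: delta_mx j 0)) in E2.
have arith (a b c d' x y : R) : a - b - (c - d') = h * (h * x) ->
    a - c - (b - d') = h * (h * y) -> x = y.
  move=> ax ay; apply/(mulfI (lt0r_neq0 h0))/(mulfI (lt0r_neq0 h0)).
  by rewrite -ax -ay; ring.
have p12 := arith _ _ _ _ _ _ E1 E2.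
rewrite p12 in P2; rewrite add0r; exact: (dist_lt_half P1 P2).
Qed.

Lemma convex_first_order (D : set 'cV[R]_k) f x x' (d : R) : convex_function D f ->
  D x -> D x' -> is_derive x (x' - x) (f : _ -> R^o) d -> f x + d <= f x'.
Proof.
move=> cf Dx Dx' fd.
apply/ler_addgt0Pr => e e0.
have [r r0 rP] := (is_derive_epsP _ _ _ _).1 fd e e0.
pose h := Num.min 1 (r / 2).
have h0 : 0 < h by rewrite lt_min ltr01; lra.
have h1 : h <= 1 by rewrite ge_min lexx.
have hr : h <= r / 2 by rewrite ge_min lexx orbT.
have /rP : `|h| < r by rewrite gtr0_norm//; lra.
rewrite (gtr0_norm h0) ler_norml [h *: d]/(h * d) => /andP[+ _].
have := cf (Itv01 (ltW h0) h1) x' x (mem_set Dx') (mem_set Dx).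
rewrite [X in f X <= _](_ : _ = h *: (x' - x) + x); last first.
  rewrite -[LHS]/(h *: x' + (1 - h) *: x).
  by apply/matrixP => i j; rewrite !mxE; ring.
have arith (a b c : R) : a <= h * b + (1 - h) * c ->
    - (e * h) <= a - c - h * d -> c + d <= b + e.
  move=> c1 c2; suff : h * (c + d) <= h * (b + e) by rewrite ler_pM2l.
  lra.
exact: arith.
Qed.

End Gradient.

(** * Concave-convex functions *)

Section SaddleFunction.
Context {R : realType} {n m : nat}.
Variables (Kx : set 'cV[R]_n) (Ky : set 'cV[R]_m) (phi : 'cV[R]_(n + m) -> R).
Local Notation K := (prod_set Kx Ky).
Local Notation f := (saddle_field phi).
Implicit Types (z w s u v : 'cV[R]_(n + m)) (x : 'cV[R]_n) (y : 'cV[R]_m).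

Lemma dot_col_mx x y z : dot (col_mx x y) z = dot x (usubmx z) + dot y (dsubmx z).
Proof.
by rewrite -{1}(vsubmxK z) /dot tr_col_mx mul_row_col mxE.
Qed.

Lemma continuous_usubmx : continuous (usubmx : 'cV[R]_(n + m) -> 'cV[R]_n).
Proof.
move=> z; apply/continuous_epsP => e e0; exists e => // w wz.
rewrite (le_lt_trans _ wz)// -raddfB; apply: mx_norm_leP => // i j.
by rewrite mxE coord_le_norm.
Qed.

Lemma continuous_dsubmx : continuous (dsubmx : 'cV[R]_(n + m) -> 'cV[R]_m).
Proof.
move=> z; apply/continuous_epsP => e e0; exists e => // w wz.
rewrite (le_lt_trans _ wz)// -raddfB; apply: mx_norm_leP => // i j.
by rewrite mxE coord_le_norm.
Qed.

Lemma closed_prod_set : closed Kx -> closed Ky -> closed K.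
Proof.
move=> cx cy; have -> : K = usubmx @^-1` Kx `&` dsubmx @^-1` Ky by [].
apply: closedI; apply: closed_comp => // z _.
  exact: continuous_usubmx.
exact: continuous_dsubmx.
Qed.

Lemma convex_prod_set : convex_set Kx -> convex_set Ky -> convex_set K.
Proof.
move=> /convex_setP cx /convex_setP cy; apply/convex_setP.
move=> z w t [zx zy] [wx wy] t0 t1.
by split; rewrite !raddfD/= !linearZ/=; [exact: cx|exact: cy].
Qed.

(** The diagonal of diag(I, -I), which turns the gradient of [phi] into the saddle field and its
    Hessian into the Jacobian A + B. *)
Definition block_sign (i : 'I_(n + m)) : R := if (i < n)%N then 1 else -1.

Lemma saddle_fieldE z i : f z i 0 = block_sign i * pderiv i phi z.
Proof.
rewrite /saddle_field /block_sign; case: (split_ordP i) => j ->.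
  by rewrite col_mxEu !mxE /= ?ltn_ord mul1r.
by rewrite col_mxEd !mxE /= ?ltnNge ?leq_addr/= mulN1r.
Qed.

Lemma Amx_add_BmxE z i j :
  (Amx phi z + Bmx phi z) i j = block_sign i * hessian phi z i j.
Proof.
rewrite /Amx /Bmx add_block_mx !add0r !addr0 /block_sign.
case: (split_ordP i) => i' ->; case: (split_ordP j) => j' ->.
- by rewrite block_mxEul !mxE /= ?ltn_ord mul1r.
- by rewrite block_mxEur !mxE /= ?ltn_ord mul1r.
- by rewrite block_mxEdl !mxE /= ?ltnNge ?leq_addr/= mulN1r.
- by rewrite block_mxEdr !mxE /= ?ltnNge ?leq_addr/= mulN1r.
Qed.

Lemma BmxE z i j : Bmx phi z i j =
  (if (i < n)%N == (j < n)%N then block_sign i else 0) * hessian phi z i j.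
Proof.
rewrite /Bmx /block_sign.
case: (split_ordP i) => i' ->; case: (split_ordP j) => j' ->.
- by rewrite block_mxEul !mxE /= ?ltn_ord mul1r.
- by rewrite block_mxEur !mxE /= ?ltn_ord ?ltnNge ?leq_addr/= mul0r.
- by rewrite block_mxEdl !mxE /= ?ltn_ord ?ltnNge ?leq_addr/= mul0r.
- by rewrite block_mxEdr !mxE /= ?ltnNge ?leq_addr/= mulN1r.
Qed.

Section Smooth.
Variable U : set 'cV[R]_(n + m).
Hypotheses (oU : open U) (C2 : C2_on U phi).

Lemma Amx_skew z : U z -> (Amx phi z)^T = - Amx phi z.
Proof.
move=> Uz; have H := hessian_sym oU C2 Uz.
rewrite /Amx tr_block_mx !trmx0 opp_block_mx !oppr0 opprK !raddfN/=.
by rewrite trmx_ursub trmx_dlsub H.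
Qed.

Lemma Bmx_sym z : U z -> (Bmx phi z)^T = Bmx phi z.
Proof.
move=> Uz; have H := hessian_sym oU C2 Uz.
rewrite /Bmx tr_block_mx !trmx0 !raddfN/=.
by rewrite trmx_ulsub trmx_drsub H.
Qed.

Lemma dot_Amx_self z v : U z -> dot v (Amx phi z *m v) = 0.
Proof.
move=> Uz; have : dot v (Amx phi z *m v) = - dot v (Amx phi z *m v).
  by rewrite {1}dotC dot_mulmxl Amx_skew// mulNmx dotNr.
lra.
Qed.

Lemma continuous_at_sum (I : finType) (F : I -> 'cV[R]_(n + m) -> R^o) z :
  (forall i, {for z, continuous (F i)}) ->
  {for z, continuous (fun w => \sum_i F i w : R^o)}.
Proof.
move=> cF.
have := @cvg_big R^o _ _ _ _ (@add_continuous R^o) _ (nbhs z) (index_enum I) F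
  (fun i => F i z) (nbhs_filter z) (fun i (_ : true) => cF i).
exact.
Qed.

Lemma continuous_saddle_field_dot z (g : 'cV[R]_(n + m) -> 'cV[R]_(n + m)) :
  U z -> {for z, continuous g} ->
  {for z, continuous (fun w => dot (f w) (g w) : R^o)}.
Proof.
move=> Uz cg.
rewrite (_ : (fun w => _) = fun w => \sum_i (block_sign i * pderiv i phi w) * g w i 0);
  last by apply/funext => w; rewrite dotE; under eq_bigr do rewrite saddle_fieldE.
apply: continuous_at_sum => i; have [_ ci] := C2.1 _ Uz i.
have cgi : {for z, continuous (fun w => g w i 0)}.
  exact: (continuous_comp cg (@coord_continuous _ _ _ i 0 (g z))).
exact: (cvgM (cvgM (cvg_cst (block_sign i)) ci) cgi).
Qed.

Lemma continuous_Bmx_dot z u v : U z ->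
  {for z, continuous (fun w => dot u (Bmx phi w *m v) : R^o)}.
Proof.
move=> Uz; rewrite (_ : (fun w => _) = fun w => \sum_(i < n + m) \sum_(j < n + m)
    (u i 0 * (if (i < n)%N == (j < n)%N then block_sign i else 0) * v j 0) *
    pderiv i (pderiv j phi) w); last first.
  apply/funext => w; rewrite dotE; apply: eq_bigr => i _.
  rewrite mxE mulr_sumr; apply: eq_bigr => j _.
  by rewrite BmxE mxE; ring.
apply: continuous_at_sum => i; apply: continuous_at_sum => j.
have [_ cij] := C2.2 j _ Uz i.
exact: (cvgM (cvg_cst _) cij).
Qed.

Lemma is_derive_saddle_field z u v : U z ->
  is_derive z v (fun w => dot u (f w) : R^o)
    (dot u ((Amx phi z + Bmx phi z) *m v)).
Proof.
move=> Uz; pose h (i : 'I_(n + m)) : 'cV[R]_(n + m) -> R^o :=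
  (u i 0 * block_sign i) \*: (pderiv i phi : _ -> R^o).
rewrite (_ : (fun w => _) = \sum_i h i); last first.
  apply/funext => w; rewrite fct_sumE dotE; apply: eq_bigr => i _.
  by rewrite saddle_fieldE mulrA.
rewrite (_ : dot u _ =
    \sum_i (u i 0 * block_sign i) *: (dot (gradient (pderiv i phi) z) v : R^o)).
  apply: is_derive_sum => i.
  exact: (is_deriveZ _ (is_derive_gradient v oU (C2.2 i) Uz)).
rewrite dotE; apply: eq_bigr => i _; rewrite -[RHS]mulrA; congr (_ * _).
rewrite mxE dotE mulr_sumr; apply: eq_bigr => j _.
rewrite Amx_add_BmxE -mulrA; congr (_ * (_ * _)).
by rewrite -(hessian_sym oU C2 Uz) !mxE.
Qed.

Section ConcaveConvex.
Hypotheses (KU : K `<=` U) (cc : concave_convex Kx Ky phi).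

Lemma concave_first_order z w : K z -> K w ->
  phi (col_mx (usubmx w) (dsubmx z)) <=
    phi z + dot (usubmx (gradient phi z)) (usubmx w - usubmx z).
Proof.
move=> Kz Kw; set x := usubmx z; set y := dsubmx z; set x' := usubmx w.
have dz := is_derive_gradient (col_mx (x' - x) 0) oU C2.1 (KU Kz).
have dx : is_derive x (x' - x) (fun x => - phi (col_mx x y) : R^o)
    (- dot (gradient phi z) (col_mx (x' - x) 0)).
  apply: is_deriveN; apply/is_derive_epsP => e e0.
  have [r r0 rP] := (is_derive_epsP _ _ _ _).1 dz e e0.
  exists r => // h /rP.
  have -> : h *: col_mx (x' - x) 0 + z = col_mx (h *: (x' - x) + x) y.
    by rewrite -{1}(vsubmxK z) scale_col_mx scaler0 add_col_mx add0r.
  by rewrite (vsubmxK z : col_mx x y = z).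
have := convex_first_order (cc.1 _ Kz.2) Kz.1 Kw.1 dx.
by rewrite vsubmxK dotC dot_col_mx dot0l addr0 (dotC (x' - x)); lra.
Qed.

Lemma convex_first_order_y z w : K z -> K w ->
  phi z + dot (dsubmx (gradient phi z)) (dsubmx w - dsubmx z) <=
    phi (col_mx (usubmx z) (dsubmx w)).
Proof.
move=> Kz Kw; set x := usubmx z; set y := dsubmx z; set y' := dsubmx w.
have dz := is_derive_gradient (col_mx 0 (y' - y)) oU C2.1 (KU Kz).
have dy : is_derive y (y' - y) (fun y => phi (col_mx x y) : R^o)
    (dot (gradient phi z) (col_mx 0 (y' - y))).
  apply/is_derive_epsP => e e0.
  have [r r0 rP] := (is_derive_epsP _ _ _ _).1 dz e e0.
  exists r => // h /rP.
  have -> : h *: col_mx 0 (y' - y) + z = col_mx x (h *: (y' - y) + y).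
    by rewrite -{1}(vsubmxK z) scale_col_mx scaler0 add_col_mx add0r.
  by rewrite (vsubmxK z : col_mx x y = z).
have := convex_first_order (cc.2 _ Kz.1) Kz.2 Kw.2 dy.
by rewrite vsubmxK dotC dot_col_mx dot0l add0r (dotC (y' - y)).
Qed.

Lemma dot_saddle_field z v : dot (f z) v =
  dot (usubmx (gradient phi z)) (usubmx v) - dot (dsubmx (gradient phi z)) (dsubmx v).
Proof. by rewrite /saddle_field dot_col_mx dotNl. Qed.

Lemma dot_saddle_fieldB z w : dot (f z) (w - z) =
  dot (usubmx (gradient phi z)) (usubmx w - usubmx z) -
  dot (dsubmx (gradient phi z)) (dsubmx w - dsubmx z).
Proof.
by rewrite dot_saddle_field (raddfB usubmx) (raddfB dsubmx).
Qed.

(** Four first-order inequalities, two concave and two convex, compare [phi z] and [phi w] with the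
    two mixed values where one block comes from [z] and the other from [w]; in their sum all values
    of [phi] cancel. *)
Lemma saddle_field_monotone z w : K z -> K w -> dot (f z - f w) (z - w) <= 0.
Proof.
have arith (a b c d A1 A2 B1 B2 : R) : c <= a + A1 -> d <= b + A2 ->
    a + B1 <= d -> b + B2 <= c -> - (A1 - B1) - (A2 - B2) <= 0 by lra.
move=> Kz Kw; rewrite dotBl -{1}(opprB w z) dotNr !dot_saddle_fieldB.
exact: arith (concave_first_order Kz Kw) (concave_first_order Kw Kz)
  (convex_first_order_y Kz Kw) (convex_first_order_y Kw Kz).
Qed.

Hypotheses (cKx : convex_set Kx) (cKy : convex_set Ky).

Lemma saddle_point_field s w : saddle_point K phi s -> K w -> dot (f s) (w - s) <= 0.
Proof.
move=> [Ks sad] Kw; have /convex_setP cx := cKx; have /convex_setP cy := cKy.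
have [[sx sy] [wx wy]] := (Ks, Kw).
have dsx := is_derive_gradient (col_mx (usubmx w - usubmx s) 0) oU C2.1 (KU Ks).
have dsy := is_derive_gradient (col_mx 0 (dsubmx w - dsubmx s)) oU C2.1 (KU Ks).
rewrite dot_saddle_field !raddfB/=.
have : dot (usubmx (gradient phi s)) (usubmx w - usubmx s) <= 0.
  have <- : dot (gradient phi s) (col_mx (usubmx w - usubmx s) 0) =
      dot (usubmx (gradient phi s)) (usubmx w - usubmx s).
    by rewrite dotC dot_col_mx dot0l addr0 dotC.
  apply: (is_derive_le0 dsx) => t t0 t1.
  rewrite -{1}(vsubmxK s) scale_col_mx scaler0 add_col_mx addr0.
  apply: (sad _ (dsubmx s) _ _).1; last by rewrite vsubmxK.
  split; rewrite ?col_mxKu ?col_mxKd//.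
  have -> : usubmx s + t *: (usubmx w - usubmx s) =
      t *: usubmx w + (1 - t) *: usubmx s.
    by apply/matrixP => i j; rewrite !mxE; ring.
  by apply: cx => //; exact: ltW.
have : - dot (dsubmx (gradient phi s)) (dsubmx w - dsubmx s) <= 0.
  have <- : dot (gradient phi s) (col_mx 0 (dsubmx w - dsubmx s)) =
      dot (dsubmx (gradient phi s)) (dsubmx w - dsubmx s).
    by rewrite dotC dot_col_mx dot0l add0r dotC.
  apply: (is_derive_le0 (is_deriveN dsy)) => t t0 t1.
  rewrite -{1}(vsubmxK s) scale_col_mx scaler0 add_col_mx addr0.
  rewrite -[leLHS]/(- phi _) -[leRHS]/(- phi _) lerN2.
  apply: (sad (usubmx s) _ _ _).2; first by rewrite vsubmxK.
  split; rewrite ?col_mxKu ?col_mxKd//.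
  have -> : dsubmx s + t *: (dsubmx w - dsubmx s) =
      t *: dsubmx w + (1 - t) *: dsubmx s.
    by apply/matrixP => i j; rewrite !mxE; ring.
  by apply: cy => //; exact: ltW.
lra.
Qed.

Lemma field_saddle_point s : K s -> (forall w, K w -> dot (f s) (w - s) <= 0) ->
  saddle_point K phi s.
Proof.
move=> Ks VI; split=> // x y Kxs Ksy; split.
- have := concave_first_order Ks Kxs; have := VI _ Kxs.
  rewrite dot_saddle_field !raddfB/= !col_mxKu !col_mxKd subrr dot0r; lra.
- have := convex_first_order_y Ks Ksy; have := VI _ Ksy.
  rewrite dot_saddle_field !raddfB/= !col_mxKu !col_mxKd subrr dot0r; lra.
Qed.

(** Minty's trick: test at [s + t *: (w - s)], which convexity keeps in [K], divide by [t] and let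
    [t] tend to 0. *)
Lemma minty_saddle_point s : K s -> (forall w, K w -> dot (f w) (w - s) <= 0) ->
  saddle_point K phi s.
Proof.
move=> Ks minty; apply: (field_saddle_point Ks) => w Kw.
have /convex_setP cK := convex_prod_set cKx cKy.
have cF : {for s, continuous (fun p => dot (f p) (w - s) : R^o)}.
  exact: (continuous_saddle_field_dot (KU Ks) (@cst_continuous _ _ (w - s) s)).
apply: (@continuous_ray_le _ _ (fun p => dot (f p) (w - s)) s (w - s) 0 cF) => t t0 t1.
have stE : s + t *: (w - s) = t *: w + (1 - t) *: s.
  by apply/matrixP => i j; rewrite !mxE; ring.
have := minty _ (cK _ _ _ Kw Ks (ltW t0) t1).
by rewrite -stE addrAC subrr add0r dotZr pmulr_rle0.
Qed.

End ConcaveConvex.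
End Smooth.
End SaddleFunction.

(** * The Euclidean norm *)

Section EuclideanNorm.
Context {R : realType} {k : nat}.
Implicit Types (u v w p q : 'cV[R]_k) (A : set 'cV[R]_k).

Lemma cauchy_schwarz u v : dot u v ^+ 2 <= dot u u * dot v v.
Proof.
have [v0|v0] := eqVneq (dot v v) 0.
  by rewrite (dot_sqr_eq0 v0) !dot0r expr0n mulr0.
have vp : 0 < dot v v by rewrite lt_neqAle eq_sym v0 dot_sqr_ge0.
have := dot_sqr_ge0 (dot v v *: u - dot u v *: v).
rewrite !dot_lin (dotC v u) => H; rewrite -subr_ge0 -(pmulr_rge0 _ vp).
by rewrite (le_trans H)// le_eqVlt; apply/orP; left; apply/eqP; ring.
Qed.

Lemma enorm_ge0 u : 0 <= enorm u. Proof. exact: sqrtr_ge0. Qed.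

Lemma enorm_sqr u : enorm u ^+ 2 = dot u u.
Proof. by rewrite sqr_sqrtr// dot_sqr_ge0. Qed.

Lemma enormN u : enorm (- u) = enorm u.
Proof. by rewrite /enorm dotNl dotNr opprK. Qed.

Lemma enorm_dist u v : enorm (u - v) = enorm (v - u).
Proof. by rewrite -enormN opprB. Qed.

Lemma ler_enormD u v : enorm (u + v) <= enorm u + enorm v.
Proof.
rewrite -(@ler_pXn2r _ 2)// ?nnegrE ?addr_ge0 ?enorm_ge0//.
rewrite sqrrD !enorm_sqr !dot_lin (dotC v u).
have : dot u v <= enorm u * enorm v.
  rewrite (le_trans (ler_norm _))// -(@ler_pXn2r _ 2)// ?nnegrE ?mulr_ge0 ?enorm_ge0//.
  by rewrite real_normK ?num_real// exprMn !enorm_sqr cauchy_schwarz.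
rewrite mulr2n; lra.
Qed.

Lemma ler_enorm_dist w u v : enorm (u - v) <= enorm (u - w) + enorm (w - v).
Proof. by rewrite -[u - v](subrKA w) ler_enormD. Qed.

Lemma closure_enorm A p (e : R) : closure A p -> 0 < e ->
  exists2 q, A q & enorm (q - p) < e.
Proof.
move=> Ap e0; have e20 : 0 < e ^+ 2 by rewrite exprn_gt0.
have [d d0 dP] := (continuous_epsP _ _).1 (@continuous_dist_sqr R k p p) _ e20.
have /Ap[q [Aq qp]] : nbhs p (ball p d) by exact: nbhsx_ballx.
exists q => //; have : `|q - p| < d by move: qp; rewrite -ball_normE/= distrC.
move=> /dP; rewrite subrr dot0l subr0 ger0_norm ?dot_sqr_ge0// => qe.
by rewrite -(@ltr_pXn2r _ 2)// ?nnegrE ?enorm_ge0 ?ltW// enorm_sqr.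
Qed.

End EuclideanNorm.

(** * Absolutely continuous curves *)

Section AbsolutelyContinuousVector.
Context {R : realType}.
Implicit Types (a b : R).

(** Walk from [a] in steps of length at most [d / 2]; each changes [g] by less than 1, and their
    number is bounded on the interval. *)
Lemma ac_fun_bounded {V : normedModType R} a b (g : R -> V) : ac_fun a b g ->
  exists2 M : R, 0 < M & forall t, a <= t <= b -> `|g t| <= M.
Proof.
move=> acg; have [d d0 dP] := acg 1 ltr01.
have step s t : a <= s -> s <= t -> t <= b -> t - s < d -> `|g t - g s| < 1.
  move=> as_ st tb ts; have := dP 1%N (fun=> s) (fun=> t).
  rewrite !big_ord1; apply; [by move=> _; split|by move=> i j; rewrite !ord1|by []].
have walk (j : nat) t : a <= t <= b -> t - a <= j%:R * (d / 2) -> `|g t - g a| <= j%:R.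
  elim: j t => [|j IH] t /andP[at_ tb].
    rewrite mul0r subr_le0 => ta; have -> : t = a by apply/le_anti/andP.
    by rewrite subrr normr0.
  rewrite -natr1 mulrDl mul1r => tj; pose s := Num.max a (t - d / 2).
  have as_ : a <= s by rewrite le_max lexx.
  have ds : t - d / 2 <= s by rewrite le_max lexx orbT.
  have st : s <= t by rewrite ge_max at_; lra.
  have sj : s - a <= j%:R * (d / 2).
    rewrite lerBlDr ge_max; apply/andP; split; last lra.
    by rewrite lerDr mulr_ge0//; lra.
  have asb : a <= s <= b by rewrite as_ (le_trans st).
  have := IH s asb sj; have : `|g t - g s| < 1 by apply: step => //; lra.
  have := ler_normD (g t - g s) (g s - g a); rewrite subrKA; lra.
pose j := Num.bound `|(b - a) / (d / 2)|.
exists (`|g a| + j%:R + 1) => [|t tab]; first by rewrite ltr_wpDl ?addr_ge0.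
have : `|g t - g a| <= j%:R.
  apply: walk => //; apply: (@le_trans _ _ (b - a)); first by move/andP : tab => []; lra.
  rewrite -ler_pdivrMr; last lra.
  by rewrite (le_trans (ler_norm _))// ltW// archi_boundP.
have := ler_normD (g t - g a) (g a); rewrite subrK; lra.
Qed.

Lemma ac_fun_dominated {V W : normedModType R} a b (g : R -> V) (h : R -> W) (C : R) :
  ac_fun a b g -> 0 < C ->
  (forall s t, a <= s -> s <= t -> t <= b -> `|h t - h s| <= C * `|g t - g s|) ->
  ac_fun a b h.
Proof.
move=> acg C0 hg e e0; have [d d0 dP] := acg _ (divr_gt0 e0 C0).
exists d => // l s t st dis std.
rewrite (@le_lt_trans _ _ (C * \sum_(i < l) `|g (t i) - g (s i)|))//.
  by rewrite mulr_sumr ler_sum// => i _; have [? ? ?] := st i; exact: hg.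
by rewrite -ltr_pdivlMl// mulrC; exact: dP.
Qed.

Lemma ac_funB {V : normedModType R} a b (g h : R -> V) :
  ac_fun a b g -> ac_fun a b h -> ac_fun a b (fun t => g t - h t).
Proof.
move=> acg ach e e0; have e20 : 0 < e / 2 by lra.
have [d1 d10 d1P] := acg _ e20; have [d2 d20 d2P] := ach _ e20.
exists (Num.min d1 d2) => [|l s t st dis]; first by rewrite lt_min d10.
rewrite lt_min => /andP[/(d1P l s t st dis) g2 /(d2P l s t st dis) h2].
apply: (@le_lt_trans _ _ (\sum_(i < l) `|g (t i) - g (s i)| +
    \sum_(i < l) `|h (t i) - h (s i)|)); last lra.
rewrite -big_split ler_sum//= => i _.
by rewrite opprD addrACA -opprD; exact: ler_normB.
Qed.

Lemma ac_fun_scale (c a b : R) : ac_fun (V := R^o) a b (fun t => c * t).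
Proof.
move=> e e0; have c0 : 0 < `|c| + 1 by rewrite ltr_wpDl.
exists (e / (`|c| + 1)) => [|l s t st dis]; first exact: divr_gt0.
rewrite ltr_pdivlMr// mulr_suml; apply: le_lt_trans.
apply: ler_sum => i _; have [_ sti _] := st i.
rewrite -mulrBr normrM (ger0_norm (_ : 0 <= t i - s i)) ?subr_ge0//.
by rewrite mulrC ler_wpM2l ?subr_ge0// lerDl.
Qed.

Lemma abs_continuous_ac_fun {k} a b (z : R -> 'cV[R]_k) :
  abs_continuous a b z -> ac_fun a b z.
Proof.
move=> acz e /acz[d d0 dP]; exists d => // l s t st dis std.
by rewrite (le_lt_trans _ (dP l s t st dis std))// ler_sum// => i _; exact: norm_le_enorm.
Qed.

Lemma ac_fun_continuous {V : normedModType R} (g : R -> V) :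
  (forall a b, ac_fun a b g) -> forall t : R^o, {for t, continuous (g : R^o -> V)}.
Proof.
move=> acg t; apply/continuous_epsP => e e0.
have [d d0 dP] := acg (t - 1) (t + 1) _ e0.
exists (Num.min d 1) => [|y]; first by rewrite lt_min d0 ltr01.
rewrite lt_min => /andP[yd y1].
have [ty|/ltW yt] := leP t y.
  have := dP 1%N (fun=> t) (fun=> y); rewrite !big_ord1; apply.
  - by move=> _; rewrite ltr_norml in y1; split; lra.
  - by move=> i j; rewrite !ord1.
  - by rewrite (le_lt_trans (ler_norm _)).
rewrite distrC; have := dP 1%N (fun=> y) (fun=> t); rewrite !big_ord1; apply.
- by move=> _; rewrite ltr_norml in y1; split; lra.
- by move=> i j; rewrite !ord1.
- by rewrite (le_lt_trans (ler_norm _))// distrC.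
Qed.

Lemma ac_fun_dot_self {k} a b (u : R -> 'cV[R]_k) : ac_fun a b u ->
  ac_fun (V := R^o) a b (fun t => dot (u t) (u t)).
Proof.
move=> acu; have [M M0 uM] := ac_fun_bounded acu.
have C0 : 0 < k%:R * (2 * M) + 1 by rewrite ltr_wpDl// !mulr_ge0// ltW.
apply: (ac_fun_dominated acu C0) => s t as_ st tb.
have -> : dot (u t) (u t) - dot (u s) (u s) = dot (u t - u s) (u t + u s).
  by rewrite !dot_lin (dotC (u s) (u t)); ring.
rewrite (le_trans (norm_dot_le _ _))// mulrCA mulrC.
rewrite ler_wpM2r// (@le_trans _ _ (k%:R * (2 * M)))//; last by rewrite lerDl.
rewrite ler_wpM2l// (le_trans (ler_normD _ _))//.
have := uM t; have := uM s; rewrite as_ tb (le_trans as_ st) (le_trans st tb).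
move=> /(_ isT) + /(_ isT); lra.
Qed.

Lemma is_derive_coord {k} (w : R -> 'cV[R]_k) (t : R^o) (dw : 'cV[R]_k) i :
  is_derive t (1 : R^o) (w : R^o -> _) dw ->
  is_derive t (1 : R^o) (fun s : R^o => w s i 0 : R^o) (dw i 0).
Proof.
move=> /is_derive_epsP H; apply/is_derive_epsP => e e0.
have [r r0 rP] := H e e0; exists r => // h /rP; apply: le_trans.
by have := coord_le_norm (w (h *: 1 + t) - w t - h *: dw) i 0; rewrite !mxE.
Qed.

Lemma ac_fun_increment_le a b (y : R -> R) (c : R) : a <= b -> ac_fun (V := R^o) a b y ->
  {ae @lebesgue_measure R, forall t, a <= t <= b ->
    exists2 d : R, is_derive (t : R^o) (1 : R^o) (y : R^o -> R^o) d & d <= c} ->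
  y b - y a <= c * (b - a).
Proof.
move=> ab acy dy; suff : y b - c * b <= y a - c * a by rewrite mulrBr; lra.
apply: (@ac_fun_nonincreasing _ _ _ (fun t => y t - c * t) ab).
  by apply: ac_funB => //; exact: ac_fun_scale.
apply: (ae_imply dy) => t {}dy /dy[d yd dc]; exists (d - c); last by rewrite subr_le0.
apply: is_deriveB; apply/is_derive_epsP => e e0; exists 1 => // r _.
rewrite -[r *: 1]/(r * 1) -[r *: c]/(r * c).
have -> : c * (r * 1 + t) - c * t - r * c = 0 by ring.
by rewrite normr0 mulr_ge0// ltW.
Qed.

(** An integral-free form of the fundamental theorem of calculus. Near [t] almost every derivative
    of a coordinate is within [e] of that of [g t]; the increment bound for the coordinate and for
    its opposite turns this into a two-sided estimate at [t] itself. *)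
Lemma ae_derive_everywhere {k} (z g : R -> 'cV[R]_k) : (forall a b, ac_fun a b z) ->
  (forall t : R^o, {for t, continuous (g : R^o -> _)}) ->
  {ae @lebesgue_measure R, forall t, is_derive (t : R^o) (1 : R^o) (z : R^o -> _) (g t)} ->
  forall t : R^o, is_derive t (1 : R^o) (z : R^o -> _) (g t).
Proof.
move=> acz cg dz t; apply/is_derive_epsP => e e0.
have [d d0 dP] := (continuous_epsP _ _).1 (cg t) e e0.
have acc a b i : ac_fun (V := R^o) a b (fun s => z s i 0).
  apply: (ac_fun_dominated (acz a b) ltr01) => s r _ _ _; rewrite mul1r.
  by have := coord_le_norm (z r - z s) i 0; rewrite !mxE.
have incr a b i : t - d < a -> a <= b -> b < t + d ->
    `|z b i 0 - z a i 0 - (b - a) * g t i 0| <= e * (b - a).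
  move=> ta ab bt.
  have near s : a <= s <= b -> `|g s i 0 - g t i 0| < e.
    move=> /andP[as_ sb]; have /dP : `|s - t| < d by rewrite ltr_norml; lra.
    by apply: le_lt_trans; have := coord_le_norm (g s - g t) i 0; rewrite !mxE.
  have up : z b i 0 - z a i 0 <= (g t i 0 + e) * (b - a).
    apply: (ac_fun_increment_le ab (acc a b i)); apply: (ae_imply dz) => s zs sab.
    exists (g s i 0); first exact: is_derive_coord.
    by have := near s sab; rewrite ltr_norml; lra.
  have dn : - z b i 0 - - z a i 0 <= (- g t i 0 + e) * (b - a).
    apply: (@ac_fun_increment_le a b (fun s => - z s i 0) _ ab).
      apply: (ac_fun_dominated (acc a b i) ltr01) => s r _ _ _.
      by rewrite mul1r -opprD normrN.
    apply: (ae_imply dz) => s zs sab; exists (- g s i 0).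
      by apply: is_deriveN; exact: is_derive_coord.
    by have := near s sab; rewrite ltr_norml; lra.
  by rewrite ler_norml; lra.
exists d => // h; rewrite [h *: 1]mulr1 ltr_norml => /andP[h1 h2].
apply: mx_norm_leP => [|i j]; first by rewrite mulr_ge0// ltW.
rewrite ord1 !mxE; have [h0|/ltW h0] := leP 0 h.
  rewrite (ger0_norm h0); have := @incr t (h + t) i; rewrite addrK; apply; lra.
rewrite (ler0_norm h0); have := @incr (h + t) t i; rewrite opprD addrCA subrr addr0 => H.
rewrite -normrN; have -> : - (z (h + t) i 0 - z t i 0 - h * g t i 0) =
  z t i 0 - z (h + t) i 0 - - h * g t i 0 by ring.
by apply: H; lra.
Qed.

Lemma is_derive_dot {k} (u v : R -> 'cV[R]_k) (t : R^o) (du dv : 'cV[R]_k) :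
  is_derive t (1 : R^o) (u : R^o -> _) du -> is_derive t (1 : R^o) (v : R^o -> _) dv ->
  is_derive t (1 : R^o) (fun s : R^o => dot (u s) (v s) : R^o)
    (dot (u t) dv + dot du (v t)).
Proof.
move=> ud vd.
rewrite (_ : (fun s => _) =
    \sum_i (fun s : R^o => u s i 0 : R^o) * (fun s : R^o => v s i 0 : R^o)).
  rewrite (_ : _ + _ = \sum_i ((u t i 0 : R^o) *: (dv i 0 : R^o) +
                               (v t i 0 : R^o) *: (du i 0 : R^o))).
    by apply: is_derive_sum => i; apply: is_deriveM; exact: is_derive_coord.
  by rewrite !dotE -big_split; apply: eq_bigr => i _; congr (_ + _); exact: mulrC.
by apply/funext => s; rewrite fct_sumE dotE.
Qed.

Lemma is_derive_unique {V : normedModType R} (g : R^o -> V) (t : R^o) (d1 d2 : V) :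
  is_derive t (1 : R^o) g d1 -> is_derive t (1 : R^o) g d2 -> d1 = d2.
Proof. by move=> [_ <-] [_ <-]. Qed.

(** Otherwise the interval of length [e] centred at [t] would lie in an open set of measure at most
    [e / 2]. *)
Lemma ae_dense (P : R -> Prop) (t e : R) : {ae @lebesgue_measure R, forall s, P s} ->
  0 < e -> exists2 s, `|s - t| < e & P s.
Proof.
move=> aeP e0; apply: contrapT => H; have e20 : 0 < e / 2 by lra.
have [U [oU NU Ue]] := negligible_open_cover aeP e20.
have := @sum_length_le _ U (e / 2) 1 (fun=> t - e / 2) (fun=> t + e / 2) oU Ue.
rewrite big_ord1 => leE; suff : t + e / 2 - (t - e / 2) <= e / 2 by clear leE; lra.
apply: leE => [_|_ s|i j]; [lra| |by rewrite !ord1].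
rewrite /= in_itv/= => /andP[s1 s2]; apply: NU => Ps; apply: H; exists s => //.
by rewrite ltr_norml; lra.
Qed.

End AbsolutelyContinuousVector.

(** * Projected flows of antitone fields *)

Section MonotoneFlow.
Context {R : realType} {k : nat}.
Variables (K : set 'cV[R]_k) (f : 'cV[R]_k -> 'cV[R]_k).
Hypothesis mono : forall p q, K p -> K q -> dot (f p - f q) (p - q) <= 0.
Implicit Types (p q s w : 'cV[R]_k) (z : R -> 'cV[R]_k) (a b c t : R).

(** The correction is allowed to be any normal vector instead of the projection. Contraction rests
    on the sign of the normal terms alone, and constant curves at equilibria qualify at once, with
    [n = f s]. *)
Definition flow_on a b z : Prop :=
  [/\ forall t, a <= t <= b -> K (z t), ac_fun a b z &
      {ae @lebesgue_measure R, forall t, a <= t <= b ->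
        exists2 n, normal_cone K (z t) n &
          is_derive (t : R^o) (1 : R^o) (z : R^o -> 'cV[R]_k) (f (z t) - n)}].

(* This includes the case without nearest point, where euclid_proj is 0. *)
Lemma euclid_proj_normal_cone p u : normal_cone K p (euclid_proj (normal_cone K p) u).
Proof.
rewrite /euclid_proj; case: xgetP => [q _ [] //|_ w Kw].
by rewrite dot0l.
Qed.

Lemma projected_solution_flow (I : set R) z a b : projected_solution K f I z ->
  I a -> I b -> (forall t, a <= t <= b -> I t) -> flow_on a b z.
Proof.
move=> [Kz acz dz] Ia Ib abI; split; first by move=> t /abI/Kz.
  exact/abs_continuous_ac_fun/acz.
apply: (ae_imply dz) => t {}dz /abI/dz ?.
by exists (euclid_proj (normal_cone K (z t)) (f (z t)));
  first exact: euclid_proj_normal_cone.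
Qed.

Lemma flow_on_shift c a b z : flow_on (a + c) (b + c) z ->
  flow_on a b (fun t => z (t + c)).
Proof.
move=> [Kz acz dz]; split.
- by move=> t /andP[a1 b1]; apply: Kz; rewrite !lerD2r a1.
- move=> e /acz[d d0 dP]; exists d => // l s t st dis std.
  apply: (dP l (fun i => s i + c) (fun i => t i + c)).
  + by move=> i; have [? ? ?] := st i; split; rewrite lerD2r.
  + by move=> i j /dis[?|?]; [left|right]; rewrite lerD2r.
  + by under eq_bigr do rewrite opprD addrACA subrr addr0.
- apply: (ae_imply (ae_shift c dz)) => t {}dz /andP[a1 b1].
  have [|n zn dn] := dz; first by rewrite !lerD2r a1.
  exists n => //; exact: is_derive_translate dn.
Qed.

Lemma flow_on_cst a b s : K s -> (forall w, K w -> dot (f s) (w - s) <= 0) ->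
  flow_on a b (fun=> s).
Proof.
move=> Ks VI; split => //.
- move=> e e0; exists 1 => // l s' t' _ _ _.
  by rewrite big1// => i _; rewrite subrr normr0.
- apply: aeW => t _; exists (f s) => [w /VI//|].
  by rewrite subrr; exact: is_derive_cst.
Qed.

(** Half the derivative of the squared distance is the antitone term plus one term for each normal
    vector, tested at the other curve; all three are nonpositive. *)
Lemma flow_on_contract a b z1 z2 : a <= b -> flow_on a b z1 -> flow_on a b z2 ->
  enorm (z1 b - z2 b) <= enorm (z1 a - z2 a).
Proof.
move=> ab [Kz1 ac1 d1] [Kz2 ac2 d2]; rewrite enorm_le.
pose u t := z1 t - z2 t.
apply: (@ac_fun_nonincreasing _ _ _ (fun t => dot (u t) (u t)) ab).
  exact/ac_fun_dot_self/ac_funB.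
apply: (ae_imply2 d1 d2) => t + + tab.
move=> /(_ tab)[n1 N1 {}d1] /(_ tab)[n2 N2 {}d2].
have du := is_deriveB d1 d2.
exists (dot (u t) (f (z1 t) - n1 - (f (z2 t) - n2)) +
        dot (f (z1 t) - n1 - (f (z2 t) - n2)) (u t)).
  exact: is_derive_dot.
have arith (d f1 f2 n1' n2' : 'cV[R]_k) : dot (f1 - f2) d <= 0 ->
    dot n1' (- d) <= 0 -> dot n2' d <= 0 ->
    dot d (f1 - n1' - (f2 - n2')) + dot (f1 - n1' - (f2 - n2')) d <= 0.
  by rewrite (dotC d) !dotBl dotNr; lra.
apply: arith; first exact: mono (Kz1 _ tab) (Kz2 _ tab).
  by rewrite opprB; exact: N1 _ (Kz2 _ tab).
exact: N2 _ (Kz1 _ tab).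
Qed.

(** A solution [y] accumulating at [z t] is close to it at two times [a] and [b = a + c], with [c]
    large. Contraction between [z] started at [t] and [y] started at [a] keeps [z (t + c)] close to
    [y b], hence to [z t]. *)
Lemma omega_limit_recurrent z t (e M : R) :
  omega_limit_trajectory K f z -> 0 < e ->
  exists2 c : R, M <= c & enorm (z (t + c) - z t) < e.
Proof.
move=> [zsol zO] e0; have e20 : 0 < e / 2 by lra.
have [x Kx [y [ysol y0] ycl]] := zO t.
have in0y (a : R) : 0 <= a -> (`[0, +oo[%classic : set R) a.
  by move=> a0; rewrite /= in_itv/= a0.
have [_ [a /= + <-] ya] := closure_enorm (ycl 0 (in0y _ (lexx _))) e20.
rewrite in_itv/= andbT => a0.
(* The absolute value gives [c >= 0] along with [M <= c], as [M] may be negative. *)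
have aM : 0 <= a + `|M| by rewrite addr_ge0.
have [_ [b /= + <-] yb] := closure_enorm (ycl _ (in0y _ aM)) e20.
rewrite in_itv/= andbT => ab.
have M0 := normr_ge0 M; have M1 := ler_norm M.
pose c := b - a; have c0 : 0 <= c by rewrite /c; lra.
exists c; first by rewrite /c; lra.
have zfl : flow_on 0 c (fun r => z (r + t)).
  by apply: flow_on_shift; exact: (projected_solution_flow zsol).
have yfl : flow_on 0 c (fun r => y (r + a)).
  apply: flow_on_shift; apply: (projected_solution_flow ysol).
  - by apply: in0y; rewrite add0r.
  - by apply: in0y; rewrite addr_ge0.
  - by move=> s /andP[s1 _]; apply: in0y; rewrite (le_trans _ s1)// add0r.
have := flow_on_contract c0 zfl yfl; rewrite !add0r subrK (addrC c).
have := ler_enorm_dist (y b) (z (t + c)) (z t).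
rewrite (enorm_dist (z t) (y a)); lra.
Qed.

Section Recurrent.
Variable z : R -> 'cV[R]_k.
Hypothesis zflow : forall a b, flow_on a b z.
Hypothesis zrec : forall t (e M : R), 0 < e ->
  exists2 c : R, M <= c & enorm (z (t + c) - z t) < e.

Lemma trajectory_in t : K (z t).
Proof. by have [+ _ _] := zflow t t; apply; rewrite lexx. Qed.

(** The distance to a constant solution is nonincreasing, and recurrence brings it arbitrarily close
    to any earlier value. *)
Lemma dist_equilibrium_constant s a b : K s ->
  (forall w, K w -> dot (f s) (w - s) <= 0) -> enorm (z a - s) = enorm (z b - s).
Proof.
move=> Ks VI.
have dec a' b' : a' <= b' -> enorm (z b' - s) <= enorm (z a' - s).
  by move=> ab; apply: flow_on_contract => //; exact: flow_on_cst.
have inc a' b' : a' <= b' -> enorm (z a' - s) <= enorm (z b' - s).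
  move=> ab; apply/ler_addgt0Pr => e e0.
  have [c cM ce] := zrec a' (b' - a') e0.
  have := ler_enorm_dist (z (a' + c)) (z a') s.
  have : enorm (z (a' + c) - s) <= enorm (z b' - s) by apply: dec; lra.
  rewrite (enorm_dist (z a') (z (a' + c))); lra.
have [ab|/ltW ba] := leP a b; apply/le_anti/andP.
  by split; [exact: inc|exact: dec].
by split; [exact: dec|exact: inc].
Qed.

Lemma dist_shift_constant t a b : enorm (z (t + a) - z (t + b)) = enorm (z a - z b).
Proof.
have dec c a' b' : a' <= b' ->
    enorm (z (b' + c) - z b') <= enorm (z (a' + c) - z a').
  move=> ab; apply: (@flow_on_contract _ _ (fun t => z (t + c))) => //.
  exact: flow_on_shift.
have inc c a' b' : 0 <= c -> a' <= b' ->
    enorm (z (a' + c) - z a') <= enorm (z (b' + c) - z b').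
  move=> c0 ab; apply/ler_addgt0Pr => e e0; have e20 : 0 < e / 2 by lra.
  have [d dM de] := zrec a' (b' - a') e20.
  (* Recurrence returns one end, [z (a' + d)], near [z a']; contraction between [z] and its shift by
     [d] does the same for the other end, [c] later. *)
  have d' : enorm (z (a' + c) - z (a' + d + c)) <= enorm (z a' - z (a' + d)).
    have := @flow_on_contract 0 c (fun t => z (t + a')) (fun t => z (t + (a' + d))) c0.
    by rewrite !add0r (addrC c) (addrC c); apply; exact: flow_on_shift.
  have := ler_enorm_dist (z (a' + d + c)) (z (a' + c)) (z a').
  have := ler_enorm_dist (z (a' + d)) (z (a' + d + c)) (z a').
  have : enorm (z (a' + d + c) - z (a' + d)) <= enorm (z (b' + c) - z b').
    by apply: dec; lra.
  rewrite (enorm_dist (z a') (z (a' + d))) in d'; lra.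
have const c a' b' : 0 <= c ->
    enorm (z (a' + c) - z a') = enorm (z (b' + c) - z b').
  move=> c0; have [ab|/ltW ba] := leP a' b'; apply/le_anti/andP.
    by split; [exact: inc|exact: dec].
  by split; [exact: dec|exact: inc].
have [ba|/ltW ab] := leP b a.
  have ba0 : 0 <= a - b by rewrite subr_ge0.
  by have := const (a - b) (t + b) b ba0; rewrite -addrA !(subrKC b).
have ab0 : 0 <= b - a by rewrite subr_ge0.
have := const (b - a) (t + a) a ab0; rewrite -addrA !(subrKC a).
by rewrite !(enorm_dist (z b)) enorm_dist.
Qed.

Hypotheses (K0 : K 0) (f0 : forall w, K w -> dot (f 0) w <= 0).

(** Polarisation: mutual distances are invariant under time shifts, and so are norms, as distances
    to the equilibrium 0. *)
Lemma gram_shift t a b : dot (z (t + a)) (z (t + b)) = dot (z a) (z b).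
Proof.
have norm c d : dot (z c) (z c) = dot (z d) (z d).
  rewrite -!enorm_sqr -(subr0 (z c)) -(subr0 (z d)).
  by congr (_ ^+ 2); apply: dist_equilibrium_constant => // w; rewrite subr0; exact: f0.
have : enorm (z (t + a) - z (t + b)) ^+ 2 = enorm (z a - z b) ^+ 2.
  by rewrite dist_shift_constant.
rewrite !enorm_sqr !dot_lin (norm (t + a) a) (norm (t + b) b).
rewrite (dotC (z (t + b))) (dotC (z b)); lra.
Qed.

(** The derivative of the constant squared distance to [s] is twice [dot (f (z t)) (z t - s) - dot n
    (z t - s)], a sum of two nonpositive terms; so both vanish. *)
Lemma flow_dot_equilibrium t s n : K s ->
  (forall w, K w -> dot (f s) (w - s) <= 0) -> normal_cone K (z t) n ->
  is_derive (t : R^o) (1 : R^o) (z : R^o -> 'cV[R]_k) (f (z t) - n) ->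
  dot (f (z t)) (z t - s) = 0 /\ dot n (z t - s) = 0.
Proof.
move=> Ks VI Nn dz; have Kt := trajectory_in t.
have d1 := is_deriveB dz (is_derive_cst s (t : R^o) 1).
have d2 := is_derive_dot d1 d1.
have d3 : is_derive (t : R^o) (1 : R^o) (fun r : R^o => dot (z r - s) (z r - s) : R^o) 0.
  rewrite (_ : (fun r => _) = cst (dot (z t - s) (z t - s))).
    exact: is_derive_cst.
  by apply/funext => r; rewrite -!enorm_sqr (dist_equilibrium_constant r t Ks VI).
have := is_derive_unique d2 d3; rewrite subr0.
have arith (u g h gs : 'cV[R]_k) : dot (g - gs) u <= 0 -> dot gs u <= 0 ->
    dot h (- u) <= 0 -> dot u (g - h) + dot (g - h) u = 0 ->
    dot g u = 0 /\ dot h u = 0.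
  rewrite (dotC u) !dotBl dotNr; lra.
apply: (arith _ _ _ (f s)); [exact: mono|exact: VI|by rewrite opprB; exact: Nn].
Qed.

End Recurrent.
End MonotoneFlow.

(** * Closed and convex sets in the Euclidean norm *)

Section EuclideanTopology.
Context {R : realType} {k : nat}.
Implicit Types (u v p q : 'cV[R]_k) (A Q : set 'cV[R]_k).

Lemma enormZ (a : R) u : enorm (a *: u) = `|a| * enorm u.
Proof. by rewrite /enorm dotZl dotZr mulrA -expr2 sqrtrM ?sqr_ge0// sqrtr_sqr. Qed.

Lemma enorm_dot_le u v : `|dot u v| <= enorm u * enorm v.
Proof.
rewrite -(@ler_pXn2r _ 2)// ?nnegrE ?mulr_ge0 ?enorm_ge0//.
by rewrite real_normK ?num_real// exprMn !enorm_sqr cauchy_schwarz.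
Qed.

Lemma enorm_le_norm u : enorm u <= (k%:R + 1) * `|u|.
Proof.
have k0 : 0 <= k%:R :> R by [].
rewrite -(@ler_pXn2r _ 2)// ?nnegrE ?mulr_ge0 ?enorm_ge0 ?addr_ge0//.
rewrite enorm_sqr (le_trans (dot_sqr_le_norm u))// exprMn ler_wpM2r ?sqr_ge0//.
nra.
Qed.

Lemma enorm_closure A p :
  (forall e : R, 0 < e -> exists2 q, A q & enorm (q - p) < e) -> closure A p.
Proof.
move=> H B /nbhs_ballP[e /= e0 eB]; have [q Aq qp] := H e e0.
exists q; split => //; apply: eB; rewrite -ball_normE/= distrC.
exact: le_lt_trans (norm_le_enorm _) qp.
Qed.

Lemma convex_closure A : convex_set A -> convex_set (closure A).
Proof.
move=> /convex_setP cA; apply/convex_setP => u v a Au Av a0 a1.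
apply: enorm_closure => e e0.
have [u' Au' uu'] := closure_enorm Au e0; have [v' Av' vv'] := closure_enorm Av e0.
exists (a *: u' + (1 - a) *: v'); first exact: cA.
have -> : a *: u' + (1 - a) *: v' - (a *: u + (1 - a) *: v) =
    a *: (u' - u) + (1 - a) *: (v' - v).
  by apply/matrixP => i j; rewrite !mxE; ring.
rewrite (le_lt_trans (ler_enormD _ _))// !enormZ !ger0_norm ?subr_ge0//.
have [->|a0'] := eqVneq a 0; first by rewrite mul0r add0r subr0 mul1r.
have ap : 0 < a by rewrite lt_neqAle eq_sym a0'.
have : a * enorm (u' - u) < a * e by rewrite ltr_pM2l.
have : (1 - a) * enorm (v' - v) <= (1 - a) * e by rewrite ler_wpM2l ?subr_ge0// ltW.
lra.
Qed.

Lemma closed_enorm_ball p (e : R) : closed [set q | enorm (q - p) <= e].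
Proof.
have [e0|e0] := leP 0 e; last first.
  rewrite (_ : [set _ | _] = set0); first exact: closed0.
  by apply/seteqP; split => // q /= /(le_trans (enorm_ge0 _)); rewrite leNgt e0.
rewrite (_ : [set _ | _] =
    (fun q => dot (q - p) (q - p) : R^o) @^-1` [set x | x <= e ^+ 2]).
  by apply: closed_comp => [q _|]; [exact: continuous_dist_sqr|exact: closed_le].
apply/seteqP; split => q /=; rewrite -enorm_sqr.
  by move=> qe; rewrite ler_pXn2r ?nnegrE ?enorm_ge0.
by rewrite ler_pXn2r ?nnegrE ?enorm_ge0.
Qed.

Lemma convex_enorm_ball p (e : R) : convex_set [set q | enorm (q - p) <= e].
Proof.
apply/convex_setP => u v a /= ue ve a0 a1.
have -> : a *: u + (1 - a) *: v - p = a *: (u - p) + (1 - a) *: (v - p).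
  by apply/matrixP => i j; rewrite !mxE; ring.
rewrite (le_trans (ler_enormD _ _))// !enormZ !ger0_norm ?subr_ge0//.
have a10 : 0 <= 1 - a by rewrite subr_ge0.
have := ler_wpM2l a0 ue; have := ler_wpM2l a10 ve; lra.
Qed.

Lemma convex_setI A Q : convex_set A -> convex_set Q -> convex_set (A `&` Q).
Proof.
move=> /convex_setP cA /convex_setP cQ; apply/convex_setP.
by move=> u v a [Au Qu] [Av Qv] a0 a1; split; [exact: cA|exact: cQ].
Qed.

End EuclideanTopology.

(** * Barycentres with a prescribed weight *)

Section WeightedPoints.
Context {R : realType} {k : nat}.
Variables (Q B : set 'cV[R]_k).
Hypotheses (cQ : convex_set Q) (cB : convex_set B) (BQ : B `<=` Q).
Implicit Types (p q b x : 'cV[R]_k) (mu : R).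

(** An elementary substitute for: [p] is the barycentre of a probability measure on [Q] giving mass
    at least [mu] to [B]. Larger masses are included because [B] is contained in [Q]. *)
Definition weighted mu p : Prop :=
  exists b q, [/\ B b, Q q & p = mu *: b + (1 - mu) *: q].

Lemma weighted_convex mu : convex_set (weighted mu).
Proof.
have [/convex_setP cQ' /convex_setP cB'] := (cQ, cB).
apply/convex_setP => p p' a [b [q [Bb Qq ->]]] [b' [q' [Bb' Qq' ->]]] a0 a1.
exists (a *: b + (1 - a) *: b'), (a *: q + (1 - a) *: q'); split.
- exact: cB'.
- exact: cQ'.
- by apply/matrixP => i j; rewrite !mxE; ring.
Qed.

Lemma convex_combine (a c : R) x y : Q x -> Q y -> 0 <= a -> 0 <= c -> 0 < a + c ->
  exists2 q, Q q & a *: x + c *: y = (a + c) *: q.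
Proof.
move=> Qx Qy a0 c0 ac; have /convex_setP cQ' := cQ.
have ac0 : a + c != 0 by rewrite gt_eqF.
exists (a / (a + c) *: x + (1 - a / (a + c)) *: y).
  by apply: cQ'; rewrite ?divr_ge0 ?ler_pdivrMr ?mul1r ?lerDl// ltW.
by apply/matrixP => i j; rewrite !mxE; field.
Qed.

(** The excess [1 / 2 - mu] of the weight of [b] is transferred to the part in [Q]. *)
Lemma weighted_half mu b x : 0 <= mu -> mu <= 1 / 2 -> B b -> Q x ->
  weighted mu ((1 / 2) *: b + (1 / 2) *: x).
Proof.
move=> mu0 mu1 Bb Qx.
have [| | |q Qq qE] := @convex_combine (1 / 2 - mu) (1 / 2) b x (BQ Bb) Qx; [lra..|].
exists b, q; split => //; have -> : 1 - mu = 1 / 2 - mu + 1 / 2 by lra.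
by rewrite -qE; apply/matrixP => i j; rewrite !mxE; ring.
Qed.

Lemma weighted_mix mu p x : 0 <= mu -> mu <= 1 -> weighted mu p -> Q x ->
  weighted (mu / 2) ((1 / 2) *: x + (1 / 2) *: p).
Proof.
move=> mu0 mu1 [b [q [Bb Qq ->]]] Qx.
have [| | |q' Qq' qE] := @convex_combine (1 / 2) ((1 - mu) / 2) x q Qx Qq; [lra..|].
exists b, q'; split => //; have -> : 1 - mu / 2 = 1 / 2 + (1 - mu) / 2 by lra.
by rewrite -qE; apply/matrixP => i j; rewrite !mxE; field.
Qed.

(** The distance from [p] to [mu *: b + (1 - mu) *: q] attains its minimum over the compact set of
    stacked pairs, and the approximations force this minimum to be 0. *)
Lemma weighted_closed mu p (M : R) : closed Q -> closed B ->
  (forall q, Q q -> enorm q <= M) ->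
  (forall e : R, 0 < e -> exists2 q, weighted mu q & enorm (q - p) < e) ->
  weighted mu p.
Proof.
move=> clQ clB QM H; pose D : set 'cV[R]_(k + k) := prod_set B Q.
pose g (v : 'cV[R]_(k + k)) := mu *: usubmx v + (1 - mu) *: dsubmx v.
have M0 : 0 <= M.
  by have [_ [_ [q [_ /QM qM _]]] _] := H 1 ltr01; exact: le_trans (enorm_ge0 q) qM.
have cD : compact D.
  apply: (@bounded_closed_compact_cV _ _ _ M); last exact: closed_prod_set.
  move=> v [/BQ/QM uM /QM dM]; apply: mx_norm_leP => // i j.
  rewrite ord1; case: (split_ordP i) => l ->.
    have := coord_le_norm (usubmx v) l 0; rewrite mxE => /le_trans; apply.
    exact: le_trans (norm_le_enorm _) uM.
  have := coord_le_norm (dsubmx v) l 0; rewrite mxE => /le_trans; apply.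
  exact: le_trans (norm_le_enorm _) dM.
have cg : continuous (fun v => dot (g v - p) (g v - p) : R^o).
  move=> v; apply: (@continuous_comp _ _ _ g (fun q => dot (q - p) (q - p) : R^o)).
    apply/continuous_epsP => e e0; have c0 : 0 < `|mu| + `|1 - mu| + 1.
      by rewrite ltr_wpDl ?addr_ge0.
    exists (e / (`|mu| + `|1 - mu| + 1)) => [|w]; first exact: divr_gt0.
    rewrite ltr_pdivlMr// => /le_lt_trans-> //.
    have -> : g w - g v = mu *: usubmx (w - v) + (1 - mu) *: dsubmx (w - v).
      by apply/matrixP => i j; rewrite !mxE; ring.
    have un : `|usubmx (w - v)| <= `|w - v|.
      by apply: mx_norm_leP => // i j; rewrite mxE coord_le_norm.
    have dn : `|dsubmx (w - v)| <= `|w - v|.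
      by apply: mx_norm_leP => // i j; rewrite mxE coord_le_norm.
    rewrite (le_trans (ler_normD _ _))// !normrZ.
    have := ler_wpM2l (normr_ge0 mu) un; have := ler_wpM2l (normr_ge0 (1 - mu)) dn.
    rewrite !mulrDr mulr1 !(mulrC `|w - v|); have := normr_ge0 (w - v); lra.
  exact: continuous_dist_sqr.
have D0 : D !=set0.
  have [_ [b [q [Bb Qq _]]] _] := H 1 ltr01.
  by exists (col_mx b q); split; rewrite ?col_mxKu ?col_mxKd.
have [v /set_mem[Bv Qv] vmin] := compact_EVT_min D0 cD (continuous_subspaceT cg).
exists (usubmx v), (dsubmx v); split => //; apply/esym/eqP; rewrite -subr_eq0.
apply/eqP/dot_sqr_eq0/le_anti; rewrite dot_sqr_ge0 andbT.
apply/ler_addgt0Pr => e e0; rewrite add0r.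
have se0 : 0 < Num.sqrt e by rewrite sqrtr_gt0.
have [_ [b [q [Bb Qq ->]]] be] := H _ se0.
have Dbq : D (col_mx b q) by split; rewrite ?col_mxKu ?col_mxKd.
have := vmin _ (mem_set Dbq); rewrite /g col_mxKu col_mxKd => /le_trans; apply.
by rewrite -enorm_sqr -(sqr_sqrtr (ltW e0)) ltW// ltr_pXn2r ?nnegrE ?enorm_ge0// ltW.
Qed.

End WeightedPoints.

(** * The ergodic mean of a recurrent trajectory *)

Section Ergodic.
Context {R : realType} {k : nat}.
Variables (K S : set 'cV[R]_k) (f : 'cV[R]_k -> 'cV[R]_k) (z : R -> 'cV[R]_k).
Hypotheses (clK : closed K) (cvK : convex_set K).
Hypothesis mono : forall p q, K p -> K q -> dot (f p - f q) (p - q) <= 0.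
Hypothesis SK : S `<=` K.
Hypothesis S_eq : forall s, S s -> forall w, K w -> dot (f s) (w - s) <= 0.
Hypothesis S_minty : forall s, K s ->
  (forall w, K w -> dot (f w) (w - s) <= 0) -> S s.
Hypothesis S0 : S 0.
Hypothesis zflow : forall a b, flow_on K f a b z.
Hypothesis zrec : forall t (e M : R), 0 < e ->
  exists2 c : R, M <= c & enorm (z (t + c) - z t) < e.
Implicit Types (p q s w : 'cV[R]_k) (c : R -> 'cV[R]_k) (a b t : R).

Let zshift t a b : enorm (z (t + a) - z (t + b)) = enorm (z a - z b).
Proof. exact: (dist_shift_constant mono zflow zrec). Qed.

Let f0 w : K w -> dot (f 0) w <= 0.
Proof. by move=> /(S_eq S0); rewrite subr0. Qed.

Let zgram t a b : dot (z (t + a)) (z (t + b)) = dot (z a) (z b).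
Proof. exact: (gram_shift mono zflow zrec (SK S0) f0). Qed.

(** Elements are whole curves, so that a time shift acts on them; their values at time 0 form the
    convex hull of the orbit. *)
Inductive shift_hull : (R -> 'cV[R]_k) -> Prop :=
| shift_hull_base t : shift_hull (fun r => z (r + t))
| shift_hull_mix a c1 c2 : 0 <= a -> a <= 1 -> shift_hull c1 -> shift_hull c2 ->
    shift_hull (fun r => a *: c1 r + (1 - a) *: c2 r).

Lemma shift_hull_in (Q : set 'cV[R]_k) c r : convex_set Q -> (forall t, Q (z t)) ->
  shift_hull c -> Q (c r).
Proof.
move=> /convex_setP cQ Qz; elim=> [t|a c1 c2 a0 a1 _ Q1 _ Q2]; first exact: Qz.
exact: cQ.
Qed.

Lemma shift_hull_gram c c' t r : shift_hull c -> shift_hull c' ->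
  dot (c (t + r)) (c' (t + r)) = dot (c r) (c' r).
Proof.
move=> hc hc'; elim: hc => [a|a c1 c2 _ _ _ IH1 _ IH2]; last first.
  by rewrite !dotDl !dotZl IH1 IH2.
elim: hc' => [b|b c1 c2 _ _ _ IH1 _ IH2]; last by rewrite !dotDr !dotZr IH1 IH2.
by rewrite /= -!addrA; exact: zgram.
Qed.

Lemma shift_hull_shift c t : shift_hull c -> shift_hull (fun r => c (r + t)).
Proof.
elim=> [b|b c1 c2 b0 b1 _ IH1 _ IH2]; last exact: shift_hull_mix.
rewrite (_ : (fun r => _) = fun r => z (r + (t + b))); first exact: shift_hull_base.
by apply/funext => r; rewrite addrA.
Qed.

Let C := [set c 0 | c in shift_hull].

Lemma shift_hull_convex : convex_set C.
Proof.
apply/convex_setP => _ _ a [c1 h1 <-] [c2 h2 <-] a0 a1.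
by exists (fun r => a *: c1 r + (1 - a) *: c2 r) => //; exact: shift_hull_mix.
Qed.

(* The point of least norm in the closed convex hull of the orbit is fixed by
   the flow, because the flow acts on the hull by isometries fixing 0. *)
Lemma ergodic_mean : exists2 p, K p & forall e : R, 0 < e ->
  exists2 c, shift_hull c & forall t, enorm (c t - p) < e.
Proof.
have C0 : closure C !=set0.
  by exists (z (0 + 0)); apply: subset_closure; exists (fun r => z (r + 0)) => //;
    exact: shift_hull_base.
have [p Cp pmin] := exists_nearest 0 (@closed_closure _ C) C0.
exists p.
  rewrite (closure_id K).1//; apply: closure_subset Cp => _ [c hc <-].
  by apply: shift_hull_in hc => // t; exact: (trajectory_in zflow).
have obt q : C q -> 0 <= dot p (q - p).
  move=> /subset_closure Cq.
  have := nearest_obtuse (convex_closure shift_hull_convex) Cp pmin Cq.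
  by rewrite subr0.
move=> e e0; have p0 := enorm_ge0 p.
(* As [enorm (c 0) <= enorm p + d] and [dot p (c t - p) >= 0], the squared distance is at most
   [2 * enorm p * d + d ^+ 2], which is below [e ^+ 2] since [d <= 1]. *)
pose d := Num.min 1 (e ^+ 2 / (2 * enorm p + 2)).
have d0 : 0 < d by rewrite lt_min ltr01 divr_gt0 ?exprn_gt0//; lra.
have d1 : d <= 1 by rewrite ge_min lexx.
have de : d * (2 * enorm p + 2) <= e ^+ 2.
  rewrite -ler_pdivlMr; last lra.
  by rewrite ge_min lexx orbT.
have [_ [c hc <-] cp] := closure_enorm Cp d0.
exists c => // t; rewrite -(@ltr_pXn2r _ 2)// ?nnegrE ?enorm_ge0 ?ltW//.
have /obt : C (c t).
  by exists (fun r => c (r + t)); [exact: shift_hull_shift|rewrite add0r].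
have ct : dot (c t) (c t) = dot (c 0) (c 0).
  by rewrite -[t]addr0 shift_hull_gram.
have c0 : enorm (c 0) <= enorm p + d.
  by have := ler_enormD (c 0 - p) p; rewrite subrK; lra.
have c02 : enorm (c 0) ^+ 2 <= (enorm p + d) ^+ 2.
  by rewrite ler_pXn2r ?nnegrE ?enorm_ge0// addr_ge0// ltW.
rewrite enorm_sqr !dot_lin ct (dotC (c t) p); rewrite !enorm_sqr in c02.
rewrite sqrrD enorm_sqr in c02.
have : d ^+ 2 <= d by rewrite expr2 -[leRHS]mulr1 ler_pM2l.
rewrite mulrDr in de; rewrite mulr2n in c02; lra.
Qed.

(** Since [f (z t)] and [n] are orthogonal to [z t], the derivative of [- dot w (z t)] equals
    [dot (f (z t) - n) (z t - w)], which is at most [dot (f w) (z t - w)]. Replacing [z t] by [z u]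
    costs [enorm (f w) * h], with [h] the same for all [u] by isometry. The result is affine in the
    curve, so it passes to convex combinations of shifts. *)
Lemma trajectory_increment w (d h u : R) : K w -> 0 <= d ->
  (forall r, 0 <= r <= d -> enorm (z r - z 0) <= h) ->
  - dot w (z (u + d) - z u) <= d * (dot (f w) (z u - w) + enorm (f w) * h).
Proof.
move=> Kw d0 zh; set A := dot (f w) _ + _.
have uud : u <= u + d by rewrite lerDl.
have [_ acz dz] := zflow u (u + d).
suff : - dot w (z (u + d)) - - dot w (z u) <= A * (u + d - u).
  by rewrite dotBr addrAC subrr add0r; lra.
apply: (@ac_fun_increment_le _ _ _ (fun t => - dot w (z t)) _ uud).
  have C0 : 0 < k%:R * `|w| + 1 by rewrite ltr_wpDl// mulr_ge0.
  apply: (ac_fun_dominated acz C0) => a b _ _ _.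
  rewrite -opprD normrN -dotBr (le_trans (norm_dot_le _ _))// mulrA ler_wpM2r//.
  by rewrite lerDl.
apply: (ae_imply dz) => t {}dz tu; have [n Nn {}dz] := dz tu.
have Kt := trajectory_in zflow t.
have [fz nz] := flow_dot_equilibrium mono zflow zrec (SK S0) (S_eq S0) Nn dz.
rewrite subr0 in fz nz.
exists (- (dot w (f (z t) - n) + dot 0 (z t))).
  exact: (is_deriveN (is_derive_dot (is_derive_cst w (t : R^o) 1) dz)).
have zt : enorm (z t - z u) <= h.
  have := zshift u (t - u) 0; rewrite addr0 subrKC => ->.
  by apply: zh; move: tu => /andP[]; lra.
have fwz : dot (f w) (z t - z u) <= enorm (f w) * h.
  rewrite (le_trans (ler_norm _))// (le_trans (enorm_dot_le _ _))//.
  by rewrite ler_wpM2l// enorm_ge0.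
have := mono Kt Kw; have := Nn _ Kw.
move: fwz; rewrite /A !dot_lin fz nz (dotC w (f (z t))) (dotC w n); lra.
Qed.

Lemma shift_hull_increment w (d h u : R) c : K w -> 0 <= d ->
  (forall r, 0 <= r <= d -> enorm (z r - z 0) <= h) -> shift_hull c ->
  - dot w (c (u + d) - c u) <= d * (dot (f w) (c u - w) + enorm (f w) * h).
Proof.
move=> Kw d0 zh; elim=> [t|a c1 c2 a0 a1 _ I1 _ I2].
  by have := @trajectory_increment w d h (u + t) Kw d0 zh; rewrite addrAC.
have a10 : 0 <= 1 - a by rewrite subr_ge0.
have := ler_wpM2l a0 I1; have := ler_wpM2l a10 I2; rewrite !dot_lin; nra.
Qed.

(** Along a curve that stays near [p] the increment is negligible, so what remains of the increment
    inequality is [0 <= d * (dot (f w) (p - w) + e)] with [d] fixed; this is Minty's inequality up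
    to [e]. *)
Lemma ergodic_mean_equilibrium p : K p ->
  (forall e : R, 0 < e -> exists2 c, shift_hull c & forall t, enorm (c t - p) < e) ->
  S p.
Proof.
move=> Kp mean; apply: (S_minty Kp) => w Kw.
have fw0 := enorm_ge0 (f w); have w0 := enorm_ge0 w.
have cz : {for (0 : R^o), continuous (z : R^o -> _)}.
  by apply: ac_fun_continuous => a b; have [] := zflow a b.
apply/ler_addgt0Pr => e e0; rewrite add0r.
pose h := e / (enorm (f w) + 1); have h0 : 0 < h by rewrite divr_gt0//; lra.
have fwh : enorm (f w) * h <= e.
  rewrite /h mulrA ler_pdivrMr; last lra.
  by rewrite mulrC ler_wpM2l// ?ltW//; lra.
have k0 : 0 < k%:R + 1 :> R by rewrite ltr_wpDl.
have [r r0 rP] := (continuous_epsP _ _).1 cz _ (divr_gt0 h0 k0).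
pose d := r / 2; have d0 : 0 < d by rewrite divr_gt0.
have zh t : 0 <= t <= d -> enorm (z t - z 0) <= h.
  move=> /andP[t0 td]; rewrite (le_trans (enorm_le_norm _))// mulrC -ler_pdivlMr//.
  by apply/ltW/rP; rewrite subr0 ger0_norm// (le_lt_trans td)// /d; lra.
suff : 0 <= d * (dot (f w) (p - w) + e).
  by rewrite pmulr_rge0// -opprB dotNr; lra.
apply/ler_addgt0Pr => e' e'0.
(* Sum of the two error coefficients, [2 * enorm w] from the increment of [c] and [d * enorm (f w)]
   from replacing [c 0] by [p], plus 1 for positivity. *)
pose b := 2 * enorm w + d * enorm (f w) + 1.
have b0 : 0 < b by rewrite ltr_wpDl// addr_ge0 ?mulr_ge0 ?enorm_ge0 ?ltW.
have [c hc cp] := mean _ (divr_gt0 e'0 b0).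
have := shift_hull_increment 0 Kw (ltW d0) zh hc.
rewrite add0r.
have cw : - (2 * enorm w * (e' / b)) <= - dot w (c d - c 0).
  rewrite lerN2 (le_trans (ler_norm _))// (le_trans (enorm_dot_le _ _))//.
  rewrite -mulrA mulrCA ler_wpM2l//.
  have := ler_enorm_dist p (c d) (c 0).
  by have := cp d; have := cp 0; rewrite (enorm_dist (c 0)); lra.
have fc : dot (f w) (c 0 - w) <= dot (f w) (p - w) + enorm (f w) * (e' / b).
  rewrite -lerBlDl -dotBr opprB addrA subrK (le_trans (ler_norm _))//.
  by rewrite (le_trans (enorm_dot_le _ _))// ler_wpM2l// ltW.
have bE : b * (e' / b) = e' by rewrite mulrC divfK// gt_eqF.
have := ler_wpM2l (ltW d0) fc; have := ler_wpM2l (ltW d0) fwh.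
have eb0 : 0 < e' / b by exact: divr_gt0.
move: bE; rewrite {1}/b; set y := e' / b in cw fc eb0 *.
rewrite !mulrDr !mulrDl; lra.
Qed.

Lemma orbit_cover (h : R) : 0 < h ->
  exists rs : seq R, forall t, exists2 r, r \in rs & enorm (z t - z r) < h.
Proof.
move=> h0; have k0 : 0 < k%:R + 1 :> R by rewrite ltr_wpDl.
have hk0 : 0 < h / (k%:R + 1) by exact: divr_gt0.
have cC : compact (closure (range z)).
  apply: (@bounded_closed_compact_cV _ _ _ (enorm (z 0) + 1)); last exact: closed_closure.
  move=> u uz; have [_ [t _ <-] tu] := closure_enorm uz (@ltr01 R).
  rewrite (le_trans (norm_le_enorm _))//.
  have := dist_equilibrium_constant mono zflow zrec t 0 (SK S0) (S_eq S0).
  rewrite !subr0; have := ler_enormD (u - z t) (z t); rewrite subrK enorm_dist; lra.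
rewrite compact_cover in cC.
have [||D _ DC] := cC R setT (fun r => ball (z r) (h / (k%:R + 1))).
- by move=> r _; exact: ball_open.
- move=> u uz; have [_ [t _ <-] tu] := closure_enorm uz hk0.
  exists t => //=; rewrite -ball_normE/=.
  exact: le_lt_trans (norm_le_enorm _) tu.
exists (finmap.enum_fset D) => t.
have /DC[r /= Dr] : closure (range z) (z t) by apply: subset_closure; exists t.
rewrite -ball_normE/= => rt; exists r => //.
by rewrite (le_lt_trans (enorm_le_norm _))// mulrC -ltr_pdivlMr// distrC.
Qed.

Let Q := K `&` [set q | enorm (q - 0) <= enorm (z 0)].

(** Iterated midpoints act as a mean over the shifts [t - r] with weights powers of 1/2. The mean of
    a curve close to [p] stays close to [p], by convexity of balls. *)
Let average (c : R -> 'cV[R]_k) t (rs : seq R) :=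
  foldr (fun r p => (1 / 2) *: c (t - r) + (1 / 2) *: p) (c 0) rs.

Lemma average_near c t rs p (e : R) : (forall r, enorm (c r - p) < e) ->
  enorm (average c t rs - p) < e.
Proof.
move=> cp; elim: rs => [|r rs IH] /=; first exact: cp.
have -> : (1 / 2) *: c (t - r) + (1 / 2) *: average c t rs - p =
    (1 / 2) *: (c (t - r) - p) + (1 / 2) *: (average c t rs - p).
  by apply/matrixP => i j; rewrite !mxE; field.
rewrite (le_lt_trans (ler_enormD _ _))// !enormZ.
have := cp (t - r); rewrite ger0_norm//; lra.
Qed.

(* Some shift in rs brings the orbit back near z t, so that every average gives
   a weight bounded below to points near z t. *)
Lemma average_weighted c t (rs : seq R) (h : R) :
  (forall a, exists2 r, r \in rs & enorm (z a - z r) < h) -> shift_hull c ->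
  weighted Q (Q `&` [set q | enorm (q - z t) <= h]) ((1 / 2) ^+ (size rs).+1)
    (average c t rs).
Proof.
move=> rsP.
have cQ : convex_set Q by apply: convex_setI => //; exact: convex_enorm_ball.
have cB : convex_set (Q `&` [set q | enorm (q - z t) <= h]).
  by apply: convex_setI => //; exact: convex_enorm_ball.
have Qz r : Q (z r).
  split; first exact: (trajectory_in zflow).
  by rewrite /= (dist_equilibrium_constant mono zflow zrec r 0 (SK S0) (S_eq S0)) subr0.
have pow1 j : (1 / 2) ^+ j.+1 <= 1 / 2 :> R.
  rewrite exprS -[leRHS]mulr1 ler_pM2l; last lra.
  by rewrite exprn_ile1//; lra.
have pow0 j : 0 <= (1 / 2) ^+ j :> R by rewrite exprn_ge0//; lra.
elim=> [a|a c1 c2 a0 a1 _ IH1 _ IH2]; last first.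
  have -> : average (fun r => a *: c1 r + (1 - a) *: c2 r) t rs =
      a *: average c1 t rs + (1 - a) *: average c2 t rs.
    elim: {rsP IH1 IH2} rs => //= r rs ->.
    by apply/matrixP => i j; rewrite !mxE; ring.
  have /convex_setP := @weighted_convex _ _ _ _ cQ cB ((1 / 2) ^+ (size rs).+1).
  exact.
have [r rrs ar] := rsP a.
have avQ rs' : Q (average (fun r => z (r + a)) t rs').
  have /convex_setP cQ' := cQ.
  elim: rs' => [|r' rs' IH] /=; first exact: Qz.
  have half : 1 / 2 = 1 - 1 / 2 :> R by lra.
  by rewrite [X in _ + X *: _]half; apply: cQ' => //; lra.
elim: {rsP} rs rrs => // r' rs IH; rewrite inE => /orP[/eqP <-|/IH rrs] /=.
  apply: (weighted_half cQ (@subIsetl _ _ _) (pow0 _) (pow1 _)) => //.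
  split; first exact: Qz.
  (* Shifting by [t - r] carries the closeness of [z a] and [z r] to that of [z (t - r + a)] and
     [z t]. *)
  have := zshift (t - r) a r; rewrite subrK => /= ->; exact: ltW.
have -> : (1 / 2) ^+ (size rs).+2 = (1 / 2) ^+ (size rs).+1 / 2 :> R.
  by rewrite exprSr mul1r.
apply: weighted_mix => //.
by rewrite (le_trans (pow1 _))//; lra.
Qed.

Lemma trajectory_in_minimal_face_span t :
  orth_compl (affine_normal_cone (affine_span (minimal_face K S))) (z t).
Proof.
have [p Kp mean] := ergodic_mean; have Sp := ergodic_mean_equilibrium Kp mean.
set W := orth_compl _; rewrite (closure_id W).1; last exact: closed_orth_compl.
apply: enorm_closure => h h0; have h20 : 0 < h / 2 by lra.
have [rs rsP] := orbit_cover h20.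
have cQ : convex_set Q by apply: convex_setI => //; exact: convex_enorm_ball.
have clQ : closed Q by apply: closedI => //; exact: closed_enorm_ball.
pose B := Q `&` [set q | enorm (q - z t) <= h / 2].
(* The weight depends on the cover only and not on how well a curve approximates [p], so it survives
   the limit. *)
pose mu : R := (1 / 2) ^+ (size rs).+1.
have [b [q [[Qb bt] Qq pE]]] : weighted Q B mu p.
  apply: (@weighted_closed _ _ _ _ _ _ _ (enorm (z 0))) => //.
  - by move=> q [].
  - by apply: closedI => //; exact: closed_enorm_ball.
  - by move=> q [_]; rewrite /= subr0.
  - move=> e /mean[c hc cp]; exists (average c t rs).
      exact: average_weighted.
    exact: average_near.
exists b; last by rewrite (le_lt_trans bt)//; lra.
apply: (minimal_face_sub_orth S0).
have mu0 : 0 < mu by rewrite exprn_gt0//; lra.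
have mu1 : mu < 1 by rewrite exprn_ilt1//; lra.
apply: (@minimal_face_segment _ _ K S cvK b q (1 - mu));
  [by case: Qb|by case: Qq|lra|lra|].
by rewrite subKr -pE; exact: sub_minimal_face.
Qed.

End Ergodic.

(** * The field along rays *)

Section MonotoneField.
Context {R : realType} {k : nat}.
Variables (K S : set 'cV[R]_k) (f : 'cV[R]_k -> 'cV[R]_k).
Hypothesis cvK : convex_set K.
Hypothesis mono : forall p q, K p -> K q -> dot (f p - f q) (p - q) <= 0.
Hypothesis cf : forall p v, K p -> {for p, continuous (fun w => dot (f w) v : R^o)}.
Hypothesis SK : S `<=` K.
Hypothesis S_eq : forall s, S s -> forall w, K w -> dot (f s) (w - s) <= 0.
Hypothesis S0 : S 0.
Implicit Types (p q s w u v : 'cV[R]_k) (r : R).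
Local Notation W := (orth_compl (affine_normal_cone (affine_span (minimal_face K S)))).
Local Notation Pi := (projection_mx W).

Lemma field0_le0 w : K w -> dot (f 0) w <= 0.
Proof. by move=> /(S_eq S0); rewrite subr0. Qed.

(** Antitonicity at [s] and 0 gives [dot (f 0) s >= dot (f s) s], and the inequality at [s] tested
    at 0 makes the right side nonnegative. *)
Lemma field0_equilibrium s : S s -> dot (f 0) s = 0.
Proof.
move=> Ss; have := mono (SK Ss) (SK S0); have := S_eq Ss (SK S0).
have := field0_le0 (SK Ss); rewrite subr0 sub0r dotNr dotBl => a1 a2 a3.
by apply/le_anti/andP; split; lra.
Qed.

Variable q : 'cV[R]_k.
Hypotheses (Kq : K q) (qS : forall s, S s -> dot (f q) (q - s) = 0).

Let fqq : dot (f q) q = 0.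
Proof. by have := qS S0; rewrite subr0. Qed.

Let f0q : dot (f 0) q = 0.
Proof.
have := mono Kq (SK S0); have := field0_le0 Kq; rewrite subr0 dotBl fqq => a1 a2.
by apply/le_anti/andP; split; lra.
Qed.

Let Kr r : 0 <= r -> r <= 1 -> K (r *: q).
Proof.
move=> r0 r1; have /convex_setP cK := cvK.
by have := cK _ _ _ Kq (SK S0) r0 r1; rewrite scaler0 addr0.
Qed.

(* A convex combination of the monotonicity inequalities at (p, 0) and (p, q)
   for p near r q on the segment from r q to w. *)
Lemma field_ray_variational r w : 0 <= r -> r <= 1 -> K w ->
  dot (f (r *: q)) (w - r *: q) <=
    (1 - r) * dot (f 0) (w - r *: q) + r * dot (f q) (w - r *: q).
Proof.
move=> r0 r1 Kw; set v := w - r *: q; have /convex_setP cK := cvK.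
apply: (@continuous_ray_le _ _ (fun p => dot (f p) v) _ v); first exact/cf/Kr.
move=> t t0 t1; have [p pE] : exists p, p = r *: q + t *: v by eexists.
rewrite -pE.
have Kp : K p.
  have -> : p = t *: w + (1 - t) *: (r *: q).
    by rewrite pE /v; apply/matrixP => i j; rewrite !mxE; ring.
  by apply: cK => //; [exact: Kr|exact: ltW].
have m0 := mono Kp (SK S0); have mq := mono Kp Kq; clearbody v.
(* With these weights [dot (f p) q] cancels, while [dot (f 0) q] and [dot (f q) q] vanish;
   everything left carries a factor [t]. *)
have E1 : (1 - r) * dot (f p - f 0) (p - 0) + r * dot (f p - f q) (p - q) =
    t * (dot (f p) v - ((1 - r) * dot (f 0) v + r * dot (f q) v)).
  have -> : p - q = t *: v - (1 - r) *: q.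
    by rewrite pE; apply/matrixP => i j; rewrite !mxE; ring.
  have f0p : dot (f 0) p = t * dot (f 0) v by rewrite pE !dot_lin f0q; ring.
  have fpp : dot (f p) p = t * dot (f p) v + r * dot (f p) q.
    by rewrite {2}pE !dot_lin; ring.
  by rewrite subr0 !dot_lin f0p fpp fqq; ring.
have : t * (dot (f p) v - ((1 - r) * dot (f 0) v + r * dot (f q) v)) <= 0.
  by rewrite -E1 -oppr_ge0 opprD addr_ge0// oppr_ge0 mulr_ge0_le0// subr_ge0.
by rewrite pmulr_rle0// subr_le0.
Qed.

Lemma projection_field0 : Pi *m f 0 = 0.
Proof.
apply/eqP; rewrite -oppr_eq0 -mulmxN; apply/eqP.
apply: (projection_mx_exposed cvK SK) => w.
  by move=> /field0_le0; rewrite dotNl; lra.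
by move=> /field0_equilibrium; rewrite dotNl => ->; rewrite oppr0.
Qed.

(* The field restricted to the ray through q is linear up to a normal vector of
   an exposed face containing S. *)
Lemma projection_field_ray r : 0 <= r -> r <= 1 -> Pi *m f (r *: q) = r *: (Pi *m f q).
Proof.
move=> r0 r1; have [->|r0'] := eqVneq r 0.
  by rewrite !scale0r projection_field0.
have [->|r1'] := eqVneq r 1; first by rewrite !scale1r.
have rp : 0 < r by rewrite lt_neqAle eq_sym r0'.
have rl : r < 1 by rewrite lt_neqAle r1'.
pose d := (1 - r) *: f 0 + r *: f q - f (r *: q).
have dv w : K w -> 0 <= dot d (w - r *: q).
  by move=> /(field_ray_variational r0 r1); rewrite /d dotBl dotDl !dotZl; lra.
(* [r *: q] lies strictly between 0 and [q], so testing at both ends gives opposite inequalities. *)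
have dq : dot d q = 0.
  have := dv _ (SK S0); have := dv _ Kq.
  rewrite sub0r -{1}[q]scale1r -scalerBl dotNr !dotZr => a1 a2.
  apply/le_anti/andP; split.
    by rewrite -(pmulr_rle0 _ rp); lra.
  by rewrite -(pmulr_rge0 _ (_ : 0 < 1 - r))// subr_gt0.
have frq : dot (f (r *: q)) q = 0.
  by have := dq; rewrite /d dotBl dotDl !dotZl fqq f0q; lra.
suff : Pi *m d = 0.
  rewrite /d mulmxBr mulmxDr -!scalemxAr projection_field0 scaler0 add0r.
  by move=> /eqP; rewrite subr_eq0 => /eqP.
apply: (projection_mx_exposed cvK SK) => w.
  by move=> /dv; rewrite dotBr dotZr dq; lra.
move=> Sw; apply/le_anti/andP; split; last first.
  by have := dv _ (SK Sw); rewrite dotBr dotZr dq; lra.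
have := mono (Kr r0 r1) (SK Sw); have := S_eq Sw (Kr r0 r1).
have := qS Sw; have := field0_equilibrium Sw.
rewrite /d !dot_lin fqq frq => -> fqw; rewrite (_ : dot (f q) w = 0); lra.
Qed.

Lemma projection_normal n : normal_cone K q n ->
  (forall s, S s -> dot n (q - s) = 0) -> Pi *m n = 0.
Proof.
move=> Nn nS; have nq : dot n q = 0 by have := nS _ S0; rewrite subr0.
apply/eqP; rewrite -oppr_eq0 -mulmxN; apply/eqP.
apply: (projection_mx_exposed cvK SK) => w.
  by move=> /Nn; rewrite dotBr nq dotNl; lra.
by move=> /nS; rewrite dotBr nq dotNl; lra.
Qed.

End MonotoneField.

Section DirectionalSlope.
Context {R : realType} {V : normedModType R}.

Lemma is_derive_ray_slope (f : V -> R^o) (x v : V) (d c : R) : is_derive x v f d ->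
  (forall t, 0 < t -> t <= 1 -> f (x + t *: v) = f x + t * c) -> d = c.
Proof.
move=> /is_derive_epsP H fc; apply/eqP; rewrite -subr_eq0 -normr_le0.
apply/ler_addgt0Pr => e e0; rewrite add0r.
have [r r0 rP] := H e e0; pose h := Num.min 1 (r / 2).
have h0 : 0 < h by rewrite lt_min ltr01; lra.
have h1 : h <= 1 by rewrite ge_min lexx.
have hr : h <= r / 2 by rewrite ge_min lexx orbT.
have /rP : `|h| < r by rewrite gtr0_norm//; lra.
rewrite [h *: v + x]addrC fc// -[h *: d]/(h * d).
have arith (a : R) : a + h * c - a - h * d = h * (c - d) by ring.
by rewrite arith normrM gtr0_norm// mulrC ler_pM2r// distrC.
Qed.

End DirectionalSlope.

(** * The Jacobian along a ray *)

Section JacobianRay.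
Context {R : realType} {k : nat}.
Variables (K S : set 'cV[R]_k) (f : 'cV[R]_k -> 'cV[R]_k) (A B : 'cV[R]_k -> 'M[R]_k).
Hypothesis cvK : convex_set K.
Hypothesis mono : forall p q, K p -> K q -> dot (f p - f q) (p - q) <= 0.
Hypothesis cf : forall p v, K p -> {for p, continuous (fun w => dot (f w) v : R^o)}.
Hypothesis SK : S `<=` K.
Hypothesis S_eq : forall s, S s -> forall w, K w -> dot (f s) (w - s) <= 0.
Hypothesis S0 : S 0.
Hypothesis jacobian : forall p u v, K p ->
  is_derive p v (fun w => dot u (f w) : R^o) (dot u ((A p + B p) *m v)).
Hypothesis skewA : forall p v, K p -> dot v (A p *m v) = 0.
Hypothesis symB : forall p, K p -> (B p)^T = B p.
Hypothesis cB : forall p u v, K p ->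
  {for p, continuous (fun w => dot u (B w *m v) : R^o)}.
Implicit Types (p q s w u v : 'cV[R]_k) (r t : R).
Local Notation W := (orth_compl (affine_normal_cone (affine_span (minimal_face K S)))).
Local Notation Pi := (projection_mx W).

Variable q : 'cV[R]_k.
Hypotheses (Kq : K q) (qW : W q) (qS : forall s, S s -> dot (f q) (q - s) = 0).

Let Kr r : 0 <= r -> r <= 1 -> K (r *: q).
Proof.
move=> r0 r1; have /convex_setP cK := cvK.
by have := cK _ _ _ Kq (SK S0) r0 r1; rewrite scaler0 addr0.
Qed.

Lemma dot_jacobian_ray r u : 0 <= r -> r <= 1 -> W u ->
  dot u ((A (r *: q) + B (r *: q)) *m q) = dot u (f q).
Proof.
move=> r0 r1 Wu.
have fu r' : 0 <= r' -> r' <= 1 -> dot u (f (r' *: q)) = r' * dot u (f q).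
  move=> r'0 r'1; rewrite (dotC u (f q)) dotC -(projection_mx_dot (f (r' *: q)) Wu).
  rewrite (projection_field_ray cvK mono cf SK S_eq S0 Kq qS r'0 r'1).
  by rewrite dotZl projection_mx_dot.
(* The identity is known on [0, 1] only, so the derivative is read on one side: backwards at
   [r = 1], forwards elsewhere. *)
have [a a0 ab] : exists2 a, a != 0 & forall t, 0 <= t -> t <= 1 ->
    0 <= r + t * a /\ r + t * a <= 1.
  have [->|rn] := eqVneq r 1.
    by exists (-1) => [|t t0 t1]; [rewrite oppr_eq0 oner_eq0|split; lra].
  have rl : r < 1 by rewrite lt_neqAle rn.
  exists (1 - r) => [|t t0 t1]; first by rewrite subr_eq0 eq_sym.
  split; first by rewrite addr_ge0// mulr_ge0// subr_ge0.
  by have := ler_wpM2r (_ : 0 <= 1 - r) t1; rewrite subr_ge0 mul1r => /(_ r1); lra.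
have dF := jacobian u (a *: q) (Kr r0 r1).
have := @is_derive_ray_slope _ _ (fun w => dot u (f w)) _ _ _ (a * dot u (f q)) dF.
rewrite -scalemxAr dotZr => H; apply: (mulfI a0); apply: H => t t0 t1.
have [b0 b1] := ab t (ltW t0) t1.
by rewrite scalerA -scalerDl (fu _ b0 b1) (fu _ r0 r1) mulrDl mulrA.
Qed.

(** As A is skew, the form is the derivative of [dot v f] along [v], and antitonicity makes this
    function at most its value at [r *: q] on the segment, provided that it stays in [K]. *)
Lemma dot_Bmx_le0 r v : 0 <= r -> r <= 1 ->
  (forall t, 0 < t -> t <= 1 -> K (r *: q + t *: v)) ->
  dot v (B (r *: q) *m v) <= 0.
Proof.
move=> r0 r1 Kv; have dF := jacobian v v (Kr r0 r1).
rewrite mulmxDl dotDr (skewA v (Kr r0 r1)) add0r in dF.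
apply: (is_derive_le0 dF) => t t0 t1.
have := mono (Kv t t0 t1) (Kr r0 r1).
by rewrite addrAC subrr add0r dotZr pmulr_rle0// dotBl !(dotC v) subr_le0.
Qed.

Lemma dot_Bmx_ray_self r : 0 <= r -> r <= 1 -> dot q (B (r *: q) *m q) = 0.
Proof.
move=> r0 r1; have := dot_jacobian_ray r0 r1 qW.
rewrite mulmxDl dotDr (skewA q (Kr r0 r1)) add0r => ->.
by have := qS S0; rewrite subr0 dotC.
Qed.

(* The nonpositive quadratic form of B vanishes on q, hence so does its polar
   form at q, in the directions along which r q can be moved within K. *)
Lemma dot_Bmx_ray_interior r w : 0 < r -> r < 1 -> K w ->
  dot w (B (r *: q) *m q) = 0.
Proof.
move=> r0 r1 Kw; have [r0' r1'] := (ltW r0, ltW r1).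
have /convex_setP cK := cvK; set M := B _.
have qq : dot q (M *m q) = 0 := dot_Bmx_ray_self r0' r1'.
have Msym u v : dot u (M *m v) = dot v (M *m u).
  by rewrite dotC dot_mulmxl (symB (Kr r0' r1')).
have quad x (a b : R) : dot (b *: x + a *: q) (M *m (b *: x + a *: q)) =
    b * b * dot x (M *m x) + 2 * (b * a) * dot x (M *m q).
  by rewrite mulmxDr -!scalemxAr !dot_lin qq (Msym q x); ring.
(* With weight at most 1/2 on [w], a displacement of size [c] becomes at most [2 * c = r * (1 - r)]
   on the ray, which is no more than the room [r] below and [1 - r] above. *)
pose v := w - r *: q; pose c := r * (1 - r) / 2.
have c0 : 0 < c by rewrite divr_gt0// mulr_gt0// subr_gt0.
have side (a : R) : `|a| <= c -> 0 <= - a * dot v (M *m q).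
  move=> ac; apply: (@quadratic_ge0 _ (- dot v (M *m v) / 4)) => t t0 t1.
  have : dot ((t / 2) *: v + a *: q) (M *m ((t / 2) *: v + a *: q)) <= 0.
    apply: dot_Bmx_le0 => // b b0 b1; pose g := b * (t / 2).
    have g0 : 0 <= g by rewrite mulr_ge0 ?divr_ge0 ?ltW.
    have g2 : g <= 1 / 2.
      have t20 : 0 <= t / 2 by lra.
      have := ler_wpM2r t20 b1; rewrite /g mul1r; lra.
    have bac : `|b * a| <= c.
      by rewrite normrM (gtr0_norm b0) (le_trans _ ac)// -[leRHS]mul1r ler_wpM2r.
    have g1 : 0 < 1 - g by lra.
    (* Regroups the perturbed point as a convex combination of [w] and a point of the ray. *)
    pose r2 := r + b * a / (1 - g).
    have bg : `|b * a / (1 - g)| <= r * (1 - r).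
      rewrite normrM normfV (gtr0_norm g1) ler_pdivrMr//.
      apply: (le_trans bac); rewrite /c; apply: ler_wpM2l; last lra.
      by rewrite mulr_ge0// subr_ge0.
    have [r2p r2l] : 0 <= r2 /\ r2 <= 1.
      move: bg; rewrite ler_norml /r2 => /andP[b1' b2'].
      have rr : 0 <= r ^+ 2 by rewrite sqr_ge0.
      have rr1 : 0 <= (1 - r) ^+ 2 by rewrite sqr_ge0.
      by rewrite !expr2 in rr rr1; split; lra.
    have -> : r *: q + b *: ((t / 2) *: v + a *: q) = g *: w + (1 - g) *: (r2 *: q).
      rewrite /v /r2 /g; apply/matrixP => i j; rewrite !mxE; field.
      by rewrite /g in g1; apply/eqP => E; move: g1; rewrite -(pmulr_rgt0 _ (_ : 0 < 2)); lra.
    by apply: cK => //; [exact: Kr|lra].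
  by rewrite quad expr2; lra.
have := side c; have := side (- c).
rewrite normrN gtr0_norm// lexx opprK => /(_ isT) a1 /(_ isT) a2.
have vq : dot v (M *m q) = 0.
  apply/le_anti/andP; split; last by rewrite -(pmulr_rge0 _ c0).
  by rewrite -(pmulr_rle0 _ c0); lra.
by move: vq; rewrite /v dotBl dotZl qq mulr0 subr0.
Qed.

(** At the ends of the ray only one sense of motion is available, so the values there are limits of
    interior ones, approached in the direction of [(1 / 2) *: q]. *)
Lemma dot_Bmx_ray r w : 0 <= r -> r <= 1 -> K w -> dot w (B (r *: q) *m q) = 0.
Proof.
move=> r0 r1 Kw.
have le0 u : (forall r', 0 < r' -> r' < 1 -> dot u (B (r' *: q) *m q) <= 0) ->
    dot u (B (r *: q) *m q) <= 0.
  move=> int; have cBu := @cB _ u q (Kr r0 r1).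
  apply: (@continuous_ray_le _ _ (fun x => dot u (B x *m q)) _ ((1 / 2 - r) *: q) 0 cBu).
  move=> t t0 t1; rewrite scalerA -scalerDl.
  have [h1 h2] : 0 < r + t * (1 / 2 - r) /\ r + t * (1 / 2 - r) < 1.
    have : 0 <= r * (1 - t) by rewrite mulr_ge0// subr_ge0.
    have : r * (1 - t) <= 1 - t by rewrite -[leRHS]mul1r ler_wpM2r// subr_ge0.
    by rewrite mulrBr; split; lra.
  exact: int.
apply/le_anti/andP; split.
  by apply: le0 => r' h0 h1; rewrite dot_Bmx_ray_interior.
have : dot (- w) (B (r *: q) *m q) <= 0; last by rewrite dotNl oppr_le0.
by apply: le0 => r' h0 h1; rewrite dotNl dot_Bmx_ray_interior// oppr0.
Qed.

Lemma projection_Bmx_ray r : 0 <= r -> r <= 1 -> Pi *m (B (r *: q) *m q) = 0.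
Proof.
move=> r0 r1; apply: (projection_mx_exposed cvK SK) => w.
  by rewrite dotC => Kw; rewrite dot_Bmx_ray.
by rewrite dotC => /SK Kw; rewrite dot_Bmx_ray.
Qed.

Lemma projection_Amx_ray r : 0 <= r -> r <= 1 ->
  Pi *m (A (r *: q) *m q) = Pi *m f q.
Proof.
move=> r0 r1; apply/eqP; rewrite -subr_eq0 -mulmxBr; apply/eqP.
have <- : Pi *m ((A (r *: q) + B (r *: q)) *m q - f q) =
    Pi *m (A (r *: q) *m q - f q).
  by rewrite mulmxDl !mulmxBr mulmxDr projection_Bmx_ray// addr0.
apply: projection_mx_eq0 => u Wu; rewrite dotC dotBr dot_jacobian_ray//.
by rewrite subrr.
Qed.

End JacobianRay.


(** * Kernel conditions and the linear equation *)

Section LinearFlow.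
Context {R : realType} {k : nat}.
Variables (K S : set 'cV[R]_k) (f : 'cV[R]_k -> 'cV[R]_k) (A B : 'cV[R]_k -> 'M[R]_k).
Hypothesis clK : closed K.
Hypothesis cvK : convex_set K.
Hypothesis mono : forall p q, K p -> K q -> dot (f p - f q) (p - q) <= 0.
Hypothesis cfg : forall p (g : 'cV[R]_k -> 'cV[R]_k), K p -> {for p, continuous g} ->
  {for p, continuous (fun w => dot (f w) (g w) : R^o)}.
Hypothesis SK : S `<=` K.
Hypothesis S_eq : forall s, S s -> forall w, K w -> dot (f s) (w - s) <= 0.
Hypothesis S_minty : forall s, K s ->
  (forall w, K w -> dot (f w) (w - s) <= 0) -> S s.
Hypothesis S0 : S 0.
Hypothesis jacobian : forall p u v, K p ->
  is_derive p v (fun w => dot u (f w) : R^o) (dot u ((A p + B p) *m v)).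
Hypothesis skewA : forall p v, K p -> dot v (A p *m v) = 0.
Hypothesis symB : forall p, K p -> (B p)^T = B p.
Hypothesis cB : forall p u v, K p ->
  {for p, continuous (fun w => dot u (B w *m v) : R^o)}.
Implicit Types (p q s w u v : 'cV[R]_k) (r t : R).
Local Notation W := (orth_compl (affine_normal_cone (affine_span (minimal_face K S)))).
Local Notation Pi := (projection_mx W).

Variable z : R -> 'cV[R]_k.
Hypothesis zO : omega_limit_trajectory K f z.

Let cf p v : K p -> {for p, continuous (fun w => dot (f w) v : R^o)}.
Proof. by move=> Kp; exact: (cfg Kp (@cst_continuous _ _ v p)). Qed.

Let zflow a b : flow_on K f a b z. Proof. exact: (projected_solution_flow zO.1). Qed.

Let zrec t (e M : R) : 0 < e ->
  exists2 c : R, M <= c & enorm (z (t + c) - z t) < e.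
Proof. exact: (omega_limit_recurrent mono _ _ zO). Qed.

Let zK t : K (z t). Proof. exact: (trajectory_in zflow t). Qed.

Let acz a b : ac_fun a b z. Proof. by have [] := zflow a b. Qed.

Let zW t : W (z t).
Proof.
exact: (trajectory_in_minimal_face_span clK cvK mono SK S_eq S_minty S0 zflow zrec t).
Qed.

Let zae : {ae @lebesgue_measure R, forall t, exists2 n, normal_cone K (z t) n &
    is_derive (t : R^o) (1 : R^o) (z : R^o -> _) (f (z t) - n)}.
Proof.
have [_ _ dz] := zO.1; apply: (ae_imply dz) => t /(_ Logic.I) ?.
by exists (euclid_proj (normal_cone K (z t)) (f (z t))) => //;
  exact: euclid_proj_normal_cone.
Qed.

(** True at almost every time, hence at times arbitrarily close to [t]; the expression is continuous
    in time. *)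
Let zS t s : S s -> dot (f (z t)) (z t - s) = 0.
Proof.
move=> Ss; apply/eqP/negPn/negP => g0.
have g0' : 0 < `|dot (f (z t)) (z t - s)| by rewrite normr_gt0.
have cz := @ac_fun_continuous _ _ _ acz t.
have cfs : {for z t, continuous (fun w => dot (f w) (w - s) : R^o)}.
  apply: (cfg (zK t)); apply/continuous_epsP => e e0; exists e => // w.
  by rewrite opprB addrA subrK.
have [d d0 dP] := (continuous_epsP _ _).1 (continuous_comp cz cfs) _ g0'.
have [r rt [n' Nn dz]] := ae_dense t zae d0.
have [fz _] := flow_dot_equilibrium mono zflow zrec (SK Ss) (S_eq Ss) Nn dz.
by have := dP _ rt; rewrite /= fz sub0r normrN ltxx.
Qed.

Let PiA r t : 0 <= r -> r <= 1 -> Pi *m (A (r *: z t) *m z t) = Pi *m f (z t).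
Proof.
move=> r0 r1.
apply: (projection_Amx_ray cvK mono cf SK S_eq S0 jacobian skewA symB cB) => //.
by move=> s; exact: zS.
Qed.

Let PiA0 t : Pi *m (A 0 *m z t) = Pi *m f (z t).
Proof. by have := PiA t (lexx _) ler01; rewrite scale0r. Qed.

Lemma omega_trajectory_kernel r t : 0 <= r <= 1 ->
  (colker (Pi *m B (r *: z t) *m Pi) `&` colker (Pi *m (A (r *: z t) - A 0) *m Pi)) (z t).
Proof.
move=> /andP[r0 r1]; split; rewrite /colker/= -!mulmxA (projection_mx_id (zW t)).
  apply: (projection_Bmx_ray cvK mono cf SK S_eq S0 jacobian skewA symB cB) => //.
  by move=> s; exact: zS.
by rewrite mulmxBl mulmxBr PiA// PiA0 subrr.
Qed.

(** The curve stays in the subspace [W], so its derivative does too and [Pi] fixes it; applying [Pi]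
    removes the normal component. The right side is continuous in time, which upgrades the almost
    sure equation to all [t]. *)
Lemma omega_trajectory_linear t :
  is_derive (t : R^o) (1 : R^o) (z : R^o -> _) (Pi *m A 0 *m Pi *m z t).
Proof.
apply: (ae_derive_everywhere (g := fun t => Pi *m A 0 *m Pi *m z t) acz).
  move=> {}t; apply/continuous_epsP => e e0; set M := Pi *m _ *m _.
  have M0 : 0 < k%:R * `|M| + 1 by rewrite ltr_wpDl// mulr_ge0.
  have cz := @ac_fun_continuous _ _ _ acz t.
  have [d d0 dP] := (continuous_epsP _ _).1 cz _ (divr_gt0 e0 M0).
  exists d => // y /dP; rewrite ltr_pdivlMr// -mulmxBr; apply: le_lt_trans.
  rewrite (le_trans (norm_mulmx_le _ _))// mulrA mulrC ler_wpM2l//.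
  by rewrite lerDl.
apply: (ae_imply zae) => {}t [n' Nn dz].
have nS s : S s -> dot n' (z t - s) = 0.
  by move=> Ss; have [] := flow_dot_equilibrium mono zflow zrec (SK Ss) (S_eq Ss) Nn dz.
have dW : W (f (z t) - n').
  move=> x Nx; have d1 := is_derive_dot dz (is_derive_cst x (t : R^o) 1).
  have d2 : is_derive (t : R^o) (1 : R^o) (fun r : R^o => dot (z r) x : R^o) 0.
    rewrite (_ : (fun r => _) = cst 0); first exact: is_derive_cst.
    by apply/funext => r; exact: zW.
  by have := is_derive_unique d1 d2; rewrite dot0r add0r.
rewrite -!mulmxA (projection_mx_id (zW t)) PiA0.
rewrite (_ : Pi *m f (z t) = f (z t) - n')//.
rewrite -[RHS](projection_mx_id dW) mulmxBr.
by rewrite (projection_normal cvK SK S0 Nn nS) subr0.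
Qed.

End LinearFlow.

Theorem corollary39 (R : realType) (n m : nat)
    (Kx : set 'cV[R]_n) (Ky : set 'cV[R]_m) (phi : 'cV[R]_(n + m) -> R) :
  closed Kx -> convex_set Kx -> closed Ky -> convex_set Ky ->
  let K : set 'cV[R]_(n + m) := prod_set Kx Ky in
  C2_on_closed K phi ->
  concave_convex Kx Ky phi ->
  saddle_point K phi 0 ->
  let F : set 'cV[R]_(n + m) := minimal_face K (saddle_point K phi) in
  let V : set 'cV[R]_(n + m) := affine_span F in
  let Pi : 'M[R]_(n + m) := projection_mx (orth_compl (affine_normal_cone V)) in
  forall z : R -> 'cV[R]_(n + m),
    omega_limit_trajectory K (saddle_field phi) z ->
    (forall t : R,
       is_derive (t : R^o) (1 : R^o) (z : R^o -> 'cV[R]_(n + m))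
         (Pi *m Amx phi 0 *m Pi *m z t)) /\
    (forall (r t : R), 0 <= r <= 1 ->
       (colker (Pi *m Bmx phi (r *: z t) *m Pi) `&`
        colker (Pi *m (Amx phi (r *: z t) - Amx phi 0) *m Pi)) (z t)).
Proof.
move=> clx cvx cly cvy K [U [oU KU C2]] cc S0 F V Pi z zO.
have mono p q : K p -> K q -> _ := @saddle_field_monotone _ _ _ _ _ _ _ oU C2 KU cc p q.
have SK : saddle_point K phi `<=` K by move=> s [].
have S_eq s : saddle_point K phi s ->
    forall w, K w -> dot (saddle_field phi s) (w - s) <= 0.
  by move=> Ss w Kw; exact: (saddle_point_field oU C2 KU cvx cvy Ss Kw).
have S_minty s : K s -> (forall w, K w -> dot (saddle_field phi w) (w - s) <= 0) ->
    saddle_point K phi s.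
  exact: (minty_saddle_point oU C2 KU cc cvx cvy).
have cfg p g (Kp : K p) := @continuous_saddle_field_dot _ _ _ phi U C2 p g (KU _ Kp).
have jac p u v (Kp : K p) := is_derive_saddle_field oU C2 u v (KU _ Kp).
have skewA p v (Kp : K p) := dot_Amx_self oU C2 v (KU _ Kp).
have symB p (Kp : K p) := Bmx_sym oU C2 (KU _ Kp).
have cB p u v (Kp : K p) := @continuous_Bmx_dot _ _ _ phi U C2 p u v (KU _ Kp).
have clK := closed_prod_set clx cly; have cvK := convex_prod_set cvx cvy.
split=> [t|r t r01].
  exact: (omega_trajectory_linear clK cvK mono cfg SK S_eq S_minty S0 jac skewA
    symB cB zO).
exact: (omega_trajectory_kernel clK cvK mono cfg SK S_eq S_minty S0 jac skewA
  symB cB zO).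
Qed.
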